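(* For every $\mathbb{R}$-scheme $X$ there exists a morphism $u\colon\mathfrak{U}_X\to\mathfrak{Z}$ of set-valued contravariant functors on the category of $\mathbb{R}$-schemes with the following properties: (a) The functor $\mathfrak{Z}$ is a real form of the automorphism group functor $\underline{\mathrm{Aut}}_{\mathbb{R}}(X)$ of $X$ (that is, of its underlying set-valued functor), depending only on the group functor structure on $\underline{\mathrm{Aut}}_{\mathbb{R}}(X)$, and whose set $\mathfrak{Z}(\mathrm{Spec}(\mathbb{R}))$ of $\mathbb{R}$-points is in natural bijection with the set $Z^1(\mathrm{Gal}(\mathbb{C}/\mathbb{R}),\mathrm{Aut}_{\mathbb{C}}(X_{\mathbb{C}}))$ of Galois $1$-cocycles with values in the group $\mathrm{Aut}_{\mathbb{C}}(X_{\mathbb{C}})$. (b) The morphism $u\colon\mathfrak{U}_X\to\mathfrak{Z}$, together with an isomorphism $\Theta_u\colon(\mathfrak{U}_X)_{\mathbb{C}}\to(\mathfrak{Z}\times\underline{X})_{\mathbb{C}}$ making $(u,\Theta_u)$ a relative form of $X$ over $\mathfrak{Z}$, is a complete family of relative real forms of $X$, in the sense that every relative form $(f\colon\mathfrak{X}\to\underline{S},\theta)$ of $X$ over an $\mathbb{R}$-scheme $S$ is obtained from it by base change: it is isomorphic to the base change of $(u,\Theta_u)$ by some morphism $\Psi\colon\underline{S}\to\mathfrak{Z}$.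
   Context: For $k=\mathbb{R},\mathbb{C}$, $\mathcal{F}_k$ is the category of set-valued contravariant functors on the category of $k$-schemes, and $\underline{X}$ is the functor of points of a $k$-scheme $X$. Products of functors in $\mathcal{F}_k$ are taken over the functor of points of $\mathrm{Spec}(k)$. For $H\in\mathrm{Ob}(\mathcal{F}_{\mathbb{R}})$, the functor $H_{\mathbb{C}}\in\mathrm{Ob}(\mathcal{F}_{\mathbb{C}})$ is defined by $H_{\mathbb{C}}(T)=H(T)$, where the $\mathbb{C}$-scheme $T$ is viewed as an $\mathbb{R}$-scheme via $\mathrm{Spec}(\mathbb{C})\to\mathrm{Spec}(\mathbb{R})$; similarly for morphisms. For an $\mathbb{R}$-scheme $S$, $S_{\mathbb{C}}=S\times_{\mathbb{R}}\mathrm{Spec}(\mathbb{C})$. The automorphism group functor of an $\mathbb{R}$-scheme $X$ is given by $\underline{\mathrm{Aut}}_{\mathbb{R}}(X)(T)=\mathrm{Aut}_T(T\times_{\mathbb{R}}X)$ for every $\mathbb{R}$-scheme $T$. A real form of $H\in\mathrm{Ob}(\mathcal{F}_{\mathbb{R}})$ is a pair $(H',\theta)$ with $H'\in\mathrm{Ob}(\mathcal{F}_{\mathbb{R}})$ and $\theta\colon H'_{\mathbb{C}}\to H_{\mathbb{C}}$ an isomorphism in $\mathcal{F}_{\mathbb{C}}$. A relative form of an $\mathbb{R}$-scheme $X$ over $H\in\mathrm{Ob}(\mathcal{F}_{\mathbb{R}})$ is a pair $(f\colon\mathfrak{X}\to H,\theta)$, where $f$ is a morphism in $\mathcal{F}_{\mathbb{R}}$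 and $\theta\colon\mathfrak{X}_{\mathbb{C}}\to(H\times\underline{X})_{\mathbb{C}}$ is an isomorphism in $\mathcal{F}_{\mathbb{C}}$ such that $f_{\mathbb{C}}=\mathrm{pr}_{H_{\mathbb{C}}}\circ\theta$. An isomorphism between relative forms $(f\colon\mathfrak{X}\to H,\theta)$ and $(f'\colon\mathfrak{X}'\to H,\theta')$ is an isomorphism $\xi\colon\mathfrak{X}'\to\mathfrak{X}$ in $\mathcal{F}_{\mathbb{R}}$ such that $f'=f\circ\xi$ and $\theta'=\theta\circ\xi_{\mathbb{C}}$. A relative form of $X$ over an $\mathbb{R}$-scheme $S$ (an $S$-form of $X$) is a relative form of $X$ over $\underline{S}$. The base change of a relative form $(f\colon\mathfrak{X}\to H,\theta)$ by a morphism $h\colon H'\to H$ is the projection $\mathrm{pr}_1\colon H'\times_{h,H,f}\mathfrak{X}\to H'$ together with the isomorphism $\mathrm{id}_{H'_{\mathbb{C}}}\times_{H_{\mathbb{C}}}\theta\colon(H'\times_H\mathfrak{X})_{\mathbb{C}}\to H'_{\mathbb{C}}\times_{H_{\mathbb{C}}}(H\times\underline{X})_{\mathbb{C}}\cong(H'\times\underline{X})_{\mathbb{C}}$. $\mathrm{Gal}(\mathbb{C}/\mathbb{R})=\{\pm1\}$ acts on $\mathrm{Aut}_{\mathbb{C}}(X_{\mathbb{C}})$ by letting $-1$ act as $\Psi\mapsto\sigma_X\circ\Psi\circ\sigma_X^{-1}$, where $\sigma_X=\mathrm{id}_X\times\tau$ is the involution of the scheme $X_{\mathbb{C}}=X\times_{\mathbb{R}}\mathrm{Spec}(\mathbb{C})$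 induced by the complex conjugation $\tau$. A $1$-cocycle is determined by the image $\Psi\in\mathrm{Aut}_{\mathbb{C}}(X_{\mathbb{C}})$ of $-1$, subject to $\sigma_X\circ\Psi\circ\sigma_X^{-1}\circ\Psi=\mathrm{id}_{X_{\mathbb{C}}}$.
   Formalization: In (b), the total space 𝔛 of the relative form over S is additionally assumed to satisfy Galois descent: 𝔛(T) is the set of conjugation-invariant elements of 𝔛(T_C) for every ℝ-scheme T; without it the claim fails, already for X = S = Spec(ℝ). *)

(* Defs.v *)
From HB Require Import structures.
From mathcomp Require Import all_boot ssralg.
From mathcomp Require Import boolp reals complex.

Set Implicit Arguments.
Unset Strict Implicit.
Unset Printing Implicit Defensive.

Import GRing.Theory.
Local Open Scope ring_scope.

Lemma rmorph_ext (A B : comPzRingType) (f g : {rmorphism A -> B}) :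
  (forall a, f a = g a) -> f = g.
Proof.
case: f g => [f [[cf] [mf]]] [g [[cg] [mg]]] /= /funext e; subst g.
by rewrite (Prop_irrelevance cf cg) (Prop_irrelevance mf mg).
Qed.

Record rfunctor := RFunctor {
  rf_obj :> comPzRingType -> Type;
  rf_map : forall A B : comPzRingType,
    {rmorphism A -> B} -> rf_obj A -> rf_obj B;
  rf_id : forall (A : comPzRingType) (x : rf_obj A), rf_map idfun x = x;
  rf_comp : forall (A B C : comPzRingType) (f : {rmorphism A -> B})
    (g : {rmorphism B -> C}) (x : rf_obj A),
    rf_map (g \o f) x = rf_map g (rf_map f x) }.

Record rmor (X Y : rfunctor) := RMor {
  rm_fun :> forall A : comPzRingType, X A -> Y A;
  rm_nat : forall (A B : comPzRingType) (f : {rmorphism A -> B}) (x : X A),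
    rm_fun (rf_map f x) = rf_map f (rm_fun x) }.

Arguments rm_fun {X Y} _ {A} _.

Lemma rmor_ext (X Y : rfunctor) (f g : rmor X Y) :
  (forall A (x : X A), f A x = g A x) -> f = g.
Proof.
case: f g => [f nf] [g ng] /= e.
have e' : f = g by apply: functional_extensionality_dep => A; apply: funext.
by subst g; rewrite (Prop_irrelevance nf ng).
Qed.

Definition rmor_id (X : rfunctor) : rmor X X :=
  @RMor X X (fun _ x => x) (fun _ _ _ _ => erefl).

Lemma rmor_comp_nat (X Y Z : rfunctor) (g : rmor Y Z) (f : rmor X Y)
    (A B : comPzRingType) (h : {rmorphism A -> B}) (x : X A) :
  g B (f B (rf_map h x)) = rf_map h (g A (f A x)).
Proof. by rewrite !rm_nat. Qed.

Definition rmor_comp (X Y Z : rfunctor) (g : rmor Y Z) (f : rmor X Y) :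
  rmor X Z := RMor (rmor_comp_nat g f).

Lemma spec_map_id (k A : comPzRingType) (x : {rmorphism k -> A}) :
  (idfun \o x : {rmorphism k -> A}) = x.
Proof. exact: rmorph_ext. Qed.

Lemma spec_map_comp (k A B C : comPzRingType) (f : {rmorphism A -> B})
    (g : {rmorphism B -> C}) (x : {rmorphism k -> A}) :
  ((g \o f) \o x : {rmorphism k -> C}) = (g \o (f \o x)).
Proof. exact: rmorph_ext. Qed.

Definition Spec (k : comPzRingType) : rfunctor :=
  @RFunctor (fun A => {rmorphism k -> A}) (fun A B f x => f \o x)
    (@spec_map_id k) (@spec_map_comp k).

Lemma Spec_mor_nat (k l : comPzRingType) (f : {rmorphism k -> l})
    (A B : comPzRingType) (g : {rmorphism A -> B}) (x : Spec l A) :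
  (rf_map g x \o f : Spec k B) = rf_map g (x \o f : Spec k A).
Proof. exact: rmorph_ext. Qed.

Definition Spec_mor (k l : comPzRingType) (f : {rmorphism k -> l}) :
  rmor (Spec l) (Spec k) :=
  @RMor (Spec l) (Spec k) (fun A x => x \o f) (Spec_mor_nat f).

Definition is_ideal (A : comPzRingType) (J : A -> Prop) : Prop :=
  [/\ J 0, forall x y, J x -> J y -> J (x + y) & forall a x, J x -> J (a * x)].

Definition generates_unit_ideal (A : comPzRingType) (I : A -> Prop) : Prop :=
  forall J : A -> Prop, is_ideal J -> (forall x, I x -> J x) -> J 1.

Definition is_localization (A B : comPzRingType) (phi : {rmorphism A -> B})
    (f : A) : Prop :=
  [/\ exists g, phi f * g = 1,
      forall b, exists a n, b * phi f ^+ n = phi a &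
      forall a, phi a = 0 -> exists n, f ^+ n * a = 0].

(** The localizations are given by arbitrary models [B i] of [A[1/f_i]] and
    [B2 i j] of [A[1/(f_i f_j)]]. *)
Definition is_zariski_sheaf (X : rfunctor) : Prop :=
  forall (A : comPzRingType) (n : nat) (f : 'I_n -> A)
    (B : 'I_n -> comPzRingType) (phi : forall i, {rmorphism A -> B i})
    (B2 : 'I_n -> 'I_n -> comPzRingType)
    (l : forall i j, {rmorphism B i -> B2 i j})
    (r : forall i j, {rmorphism B j -> B2 i j}),
  generates_unit_ideal (fun a => exists i, a = f i) ->
  (forall i, is_localization (phi i) (f i)) ->
  (forall i j, is_localization (l i j \o phi i) (f i * f j)) ->
  (forall i j a, l i j (phi i a) = r i j (phi j a)) ->
  forall x : forall i, X (B i),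
  (forall i j, rf_map (l i j) (x i) = rf_map (r i j) (x j)) ->
  exists! y : X A, forall i, rf_map (phi i) y = x i.

(** [j] is an open immersion if it is injective and for every [x : X A] the
    preimage of its image under [x : Spec A -> X] is the complement of the
    closed subscheme [V(I)] of [Spec A] for some [I]. *)
Definition is_open_immersion (U X : rfunctor) (j : rmor U X) : Prop :=
  (forall A : comPzRingType, injective (j A)) /\
  forall (A : comPzRingType) (x : X A), exists I : A -> Prop,
  forall (B : comPzRingType) (phi : {rmorphism A -> B}),
    (exists u : U B, j B u = rf_map phi x) <->
    generates_unit_ideal (fun b => exists2 a, I a & b = phi a).

Definition is_field (K : comPzRingType) : Prop :=
  1 <> 0 :> K /\ forall x : K, x <> 0 -> exists y, x * y = 1.

(** The charts [j i] cover [X] when they do so on points with values in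
    fields. The index set lives in the universe of the carriers of rings: a
    scheme has a small set of points. *)
Definition has_open_affine_cover (X : rfunctor) : Prop :=
  exists (I : Type@{GRing.ComPzRing.axioms_.u0}) (A : I -> comPzRingType)
    (j : forall i, rmor (Spec (A i)) X),
  (forall i, is_open_immersion (j i)) /\
  forall K : comPzRingType, is_field K ->
  forall x : X K, exists i (u : Spec (A i) K), j i K u = x.

(** Schemes are defined through their functors of points on commutative rings,
    as Zariski sheaves with an open affine cover (Demazure-Gabriel, Groupes
    algebriques, I, par. 1); this gives the usual category of schemes. The zero
    ring is a ring here, whence the use of [comPzRingType]. *)
Record scheme := Scheme {
  sch_fun :> rfunctor;
  sch_sheaf : is_zariski_sheaf sch_fun;
  sch_cover : has_open_affine_cover sch_fun }.

Lemma ideal_sum (A : comPzRingType) (J : A -> Prop) (n : nat) (F : 'I_n -> A) :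
  is_ideal J -> (forall i, J (F i)) -> J (\sum_i F i).
Proof. by move=> [J0 JD _] JF; apply: big_ind. Qed.

Lemma ideal_radical (A : comPzRingType) (J : A -> Prop) :
  is_ideal J -> is_ideal (fun a => exists n, J (a ^+ n)).
Proof.
move=> iJ; have [J0 JD JM] := iJ; split.
- by exists 1%N; rewrite expr1.
- move=> x y [m xm] [n yn]; exists (m + n)%N.
  rewrite exprDn; apply: ideal_sum => // i.
  rewrite -mulr_natl; apply: (JM).
  case: (leqP n i) => [ni|ini].
    by rewrite -(subnK ni) exprD mulrA; apply: (JM).
  have mi : (m <= m + n - i)%N by rewrite -addnBA ?leq_addr // ltnW.
  by rewrite -(subnK mi) exprD mulrC mulrA; apply: (JM).
- by move=> a x [n xn]; exists n; rewrite exprMn; apply: (JM).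
Qed.

Lemma unit_ideal_radical (A : comPzRingType) (I J : A -> Prop) :
  generates_unit_ideal I -> is_ideal J ->
  (forall a, I a -> exists n, J (a ^+ n)) -> J 1.
Proof.
move=> uI iJ IJ.
by have [n] := uI _ (ideal_radical iJ) IJ; rewrite expr1n.
Qed.

Lemma annihilator_ideal (A : comPzRingType) (a : A) :
  is_ideal (fun b => b * a = 0).
Proof.
split=> [|x y xa ya|b x xa]; first by rewrite mul0r.
- by rewrite mulrDl xa ya addr0.
- by rewrite -mulrA xa mulr0.
Qed.

Lemma localization_separated (A : comPzRingType) (n : nat) (f : 'I_n -> A)
    (B : 'I_n -> comPzRingType) (phi : forall i, {rmorphism A -> B i}) :
  generates_unit_ideal (fun a => exists i, a = f i) ->
  (forall i, is_localization (phi i) (f i)) ->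
  forall a b : A, (forall i, phi i a = phi i b) -> a = b.
Proof.
move=> uf lf a b ab; apply/eqP; rewrite -subr_eq0 -[a - b]mul1r; apply/eqP.
apply: (unit_ideal_radical uf (annihilator_ideal (a - b))) => _ [i ->].
by have [_ _] := lf i; apply; rewrite rmorphB ab subrr.
Qed.

Lemma unit_ideal_sum (A : comPzRingType) (n : nat) (f : 'I_n -> A) :
  generates_unit_ideal (fun a => exists i, a = f i) ->
  exists c : 'I_n -> A, \sum_i c i * f i = 1.
Proof.
move=> uf; apply: (uf (fun a => exists c : 'I_n -> A, \sum_i c i * f i = a)).
  split.
  - by exists (fun=> 0); rewrite big1 // => i _; rewrite mul0r.
  - move=> _ _ [c <-] [d <-]; exists (fun i => c i + d i).
    by rewrite -big_split /=; apply: eq_bigr => i _; rewrite mulrDl.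
  - move=> a _ [c <-]; exists (fun i => a * c i).
    by rewrite big_distrr /=; apply: eq_bigr => i _; rewrite mulrA.
move=> _ [i ->]; exists (fun j => if j == i then 1 else 0).
rewrite (bigD1 i) //= eqxx mul1r big1 ?addr0 // => j /negbTE ->.
by rewrite mul0r.
Qed.

Lemma unit_ideal_pow (A : comPzRingType) (n : nat) (f : 'I_n -> A) (N : nat) :
  generates_unit_ideal (fun a => exists i, a = f i) ->
  generates_unit_ideal (fun a => exists i, a = f i ^+ N).
Proof.
move=> uf J iJ JN; apply: (unit_ideal_radical uf iJ) => _ [i ->].
by exists N; apply: JN; exists i.
Qed.

Lemma localization_cancel (A B : comPzRingType) (phi : {rmorphism A -> B})
    (f : A) (N : nat) (x y : B) :
  is_localization phi f -> x * phi f ^+ N = y * phi f ^+ N -> x = y.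
Proof.
case=> [[g fg] _ _] e.
have u : phi f ^+ N * g ^+ N = 1 by rewrite -exprMn fg expr1n.
by rewrite -[x]mulr1 -[y]mulr1 -u !mulrA e.
Qed.

Lemma localization_glue (A : comPzRingType) (n : nat) (f : 'I_n -> A)
    (B : 'I_n -> comPzRingType) (phi : forall i, {rmorphism A -> B i})
    (B2 : 'I_n -> 'I_n -> comPzRingType)
    (l : forall i j, {rmorphism B i -> B2 i j})
    (r : forall i j, {rmorphism B j -> B2 i j}) :
  generates_unit_ideal (fun a => exists i, a = f i) ->
  (forall i, is_localization (phi i) (f i)) ->
  (forall i j, is_localization (l i j \o phi i) (f i * f j)) ->
  (forall i j a, l i j (phi i a) = r i j (phi j a)) ->
  forall x : forall i, B i, (forall i j, l i j (x i) = r i j (x j)) ->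
  exists a, forall i, phi i a = x i.
Proof.
move=> uf lf lf2 lr x xx.
have [/= p Hp] : {p : 'I_n -> A * nat &
    forall i, x i * phi i (f i) ^+ (p i).2 = phi i (p i).1}.
  apply: (choice (P := fun i p => x i * phi i (f i) ^+ p.2 = phi i p.1)) => i.
  by have [_ /(_ (x i)) [a [m e]] _] := lf i; exists (a, m).
pose m := \max_i (p i).2.
have [a1 Ha1] : exists a1 : 'I_n -> A,
    forall i, x i * phi i (f i) ^+ m = phi i (a1 i).
  exists (fun i => f i ^+ (m - (p i).2) * (p i).1) => i.
  have pm : ((p i).2 <= m)%N by apply: (leq_bigmax i).
  by rewrite -(subnK pm) exprD mulrCA Hp rmorphM rmorphXn addnK.
have [/= q Hq] : {q : 'I_n * 'I_n -> nat & forall ij : 'I_n * 'I_n,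
    (f ij.1 * f ij.2) ^+ q ij *
      (f ij.2 ^+ m * a1 ij.1 - f ij.1 ^+ m * a1 ij.2) = 0}.
  apply: (choice (P := fun (ij : 'I_n * 'I_n) q => (f ij.1 * f ij.2) ^+ q *
      (f ij.2 ^+ m * a1 ij.1 - f ij.1 ^+ m * a1 ij.2) = 0)) => -[i j] /=.
  have [_ _] := lf2 i j; apply.
  rewrite /= !rmorphB; apply/eqP; rewrite subr_eq0; apply/eqP.
  rewrite !rmorphM -Ha1 rmorphM xx (lr i j (a1 j)) -Ha1 rmorphM !rmorphXn.
  by rewrite !lr mulrC -mulrA mulrCA.
pose M := \max_ij q ij.
pose N := (m + M)%N.
pose a2 i := f i ^+ M * a1 i.
have Ha2 i : x i * phi i (f i) ^+ N = phi i (a2 i).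
  by rewrite /N exprD mulrA Ha1 /a2 rmorphM rmorphXn mulrC.
have e2 i j : f j ^+ N * a2 i = f i ^+ N * a2 j.
  have qM : (q (i, j) <= M)%N by apply: (leq_bigmax (i, j)).
  apply/eqP; rewrite -subr_eq0; apply/eqP.
  transitivity ((f i * f j) ^+ M * (f j ^+ m * a1 i - f i ^+ m * a1 j)).
    rewrite mulrBr /a2 /N !exprMn !exprD; congr (_ - _).
      by rewrite mulrACA [RHS]mulrACA; congr (_ * _); rewrite mulrC.
    by rewrite !mulrA; congr (_ * _); rewrite -mulrA mulrC.
  by rewrite -(subnK qM) exprD -mulrA (Hq (i, j)) mulr0.
have [c c1] := unit_ideal_sum (unit_ideal_pow (N := N) uf).
exists (\sum_i c i * a2 i) => j.
apply: (localization_cancel (N := N) (lf j)).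
rewrite Ha2 -rmorphXn -rmorphM; congr (phi j _).
rewrite big_distrl /= -[RHS]mul1r -c1 big_distrl /=.
by apply: eq_bigr => i _; rewrite -[LHS]mulrA -[RHS]mulrA [a2 i * _]mulrC e2.
Qed.

Lemma mk_rmorph (A B : comPzRingType) (f : A -> B) :
  {morph f : x y / x + y} -> {morph f : x y / x * y} -> f 1 = 1 ->
  exists g : {rmorphism A -> B}, forall a, g a = f a.
Proof.
move=> fD fM f1.
have f0 : f 0 = 0 by apply: (addrI (f 0)); rewrite -fD !addr0.
have nf : nmod_morphism f by [].
have mf : monoid_morphism f by [].
pose h1 := GRing.isNmodMorphism.Build A B f nf.
pose h2 := GRing.isMonoidMorphism.Build A B f mf.
pose g : {rmorphism A -> B} := HB.pack f h1 h2.
by exists g.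
Qed.

Lemma Spec_sheaf (k : comPzRingType) : is_zariski_sheaf (Spec k).
Proof.
move=> A n f B phi B2 l r uf lf lf2 lr x xx.
have xxE i j (c : k) : l i j (x i c) = r i j (x j c).
  by have /(congr1 (fun h : {rmorphism k -> B2 i j} => h c)) := xx i j.
have [y Hy] : {y : k -> A & forall c i, phi i (y c) = x i c}.
  apply: (choice (P := fun c a => forall i, phi i a = x i c)) => c.
  exact: (localization_glue uf lf lf2 lr (x := fun i => x i c)).
have sep := localization_separated uf lf.
have [g gE] : exists g : {rmorphism k -> A}, forall c, g c = y c.
  apply: mk_rmorph.
  - by move=> c d; apply: sep => i; rewrite rmorphD !Hy rmorphD.
  - by move=> c d; apply: sep => i; rewrite rmorphM !Hy rmorphM.
  - by apply: sep => i; rewrite Hy !rmorph1.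
exists g; split=> [i|h Hh]; first by apply: rmorph_ext => c /=; rewrite gE Hy.
apply: rmorph_ext => c; rewrite gE; apply: sep => i; rewrite Hy.
by rewrite -(Hh i).
Qed.

Lemma Spec_cover (k : comPzRingType) : has_open_affine_cover (Spec k).
Proof.
exists unit, (fun=> k), (fun=> rmor_id (Spec k)); split=> [_|K _ x]; last first.
  by exists tt, x.
split=> [A x y //|A x].
exists (fun a => a = 1) => B phi; split=> [_ J _ J1|_].
  by apply: J1; exists 1; rewrite ?rmorph1.
by exists (rf_map phi x).
Qed.

Definition affine_scheme (k : comPzRingType) : scheme :=
  Scheme (Spec_sheaf (k := k)) (Spec_cover k).

Section Pushout.

Variables (k A B : comPzRingType).
Variables (f : {rmorphism k -> A}) (g : {rmorphism k -> B}).

Inductive po_term : Type :=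
  | po_inl of A
  | po_inr of B
  | po_add of po_term & po_term
  | po_mul of po_term & po_term.

Fixpoint po_eval (D : comPzRingType) (u : A -> D) (v : B -> D) (t : po_term) :
    D :=
  match t with
  | po_inl a => u a
  | po_inr b => v b
  | po_add s t => po_eval u v s + po_eval u v t
  | po_mul s t => po_eval u v s * po_eval u v t
  end.

(** Two terms are identified when they agree in every commutative ring under
    [A] and [B] whose two [k]-algebra structures coincide. *)
Definition po_eq (s t : po_term) : Prop :=
  forall (D : comPzRingType) (u : {rmorphism A -> D}) (v : {rmorphism B -> D}),
  (forall c, u (f c) = v (g c)) -> po_eval u v s = po_eval u v t.

Definition po_ring : Type := {P : po_term -> Prop | exists t, P = po_eq t}.

Definition po_class (t : po_term) : po_ring :=
  exist _ (po_eq t) (ex_intro _ t erefl).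

Definition po_repr (x : po_ring) : po_term := projT1 (cid (proj2_sig x)).

Lemma po_ext (x y : po_ring) : proj1_sig x = proj1_sig y -> x = y.
Proof.
case: x y => [P hP] [Q hQ] /= e; subst Q.
by rewrite (Prop_irrelevance hP hQ).
Qed.

Lemma po_eq_class (s t : po_term) : po_eq s t -> po_class s = po_class t.
Proof.
move=> st; apply: po_ext => /=; apply: funext => r; apply: propext; split.
- by move=> sr D u v uv; rewrite -(st _ u v uv); apply: sr.
- by move=> tr D u v uv; rewrite (st _ u v uv); apply: tr.
Qed.

Lemma po_reprK (x : po_ring) : po_class (po_repr x) = x.
Proof.
by apply: po_ext; rewrite /po_repr /=; case: cid => t /= ->.
Qed.

Lemma po_classK (D : comPzRingType) (u : {rmorphism A -> D})
    (v : {rmorphism B -> D}) (uv : forall c, u (f c) = v (g c)) (t : po_term) :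
  po_eval u v (po_repr (po_class t)) = po_eval u v t.
Proof.
rewrite /po_repr; case: cid => s /= ts.
have st : po_eq s t by rewrite -ts.
exact: st uv.
Qed.

Definition po_lift2 (op : po_term -> po_term -> po_term) (x y : po_ring) :=
  po_class (op (po_repr x) (po_repr y)).

HB.instance Definition _ := gen_eqMixin po_ring.
HB.instance Definition _ := gen_choiceMixin po_ring.

Definition po_opp (x : po_ring) : po_ring :=
  po_class (po_mul (po_inl (- 1)) (po_repr x)).

Lemma po_addA : associative (po_lift2 po_add).
Proof.
move=> x y z; apply: po_eq_class => D u v uv /=.
by rewrite !(po_classK uv) /= addrA.
Qed.

Lemma po_addC : commutative (po_lift2 po_add).
Proof. by move=> x y; apply: po_eq_class => D u v uv /=; rewrite addrC. Qed.

Lemma po_add0 : left_id (po_class (po_inl 0)) (po_lift2 po_add).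
Proof.
move=> x; rewrite -[RHS]po_reprK; apply: po_eq_class => D u v uv /=.
by rewrite (po_classK uv) /= rmorph0 add0r.
Qed.

Lemma po_addN : left_inverse (po_class (po_inl 0)) po_opp (po_lift2 po_add).
Proof.
move=> x; apply: po_eq_class => D u v uv /=.
by rewrite (po_classK uv) /= rmorphN rmorph1 rmorph0 mulN1r addNr.
Qed.

HB.instance Definition _ :=
  GRing.isZmodule.Build po_ring po_addA po_addC po_add0 po_addN.

Lemma po_mulA : associative (po_lift2 po_mul).
Proof.
move=> x y z; apply: po_eq_class => D u v uv /=.
by rewrite !(po_classK uv) /= mulrA.
Qed.

Lemma po_mulC : commutative (po_lift2 po_mul).
Proof. by move=> x y; apply: po_eq_class => D u v uv /=; rewrite mulrC. Qed.

Lemma po_mul1 : left_id (po_class (po_inl 1)) (po_lift2 po_mul).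
Proof.
move=> x; rewrite -[RHS]po_reprK; apply: po_eq_class => D u v uv /=.
by rewrite (po_classK uv) /= rmorph1 mul1r.
Qed.

Lemma po_mulDl : left_distributive (po_lift2 po_mul) (po_lift2 po_add).
Proof.
move=> x y z; apply: po_eq_class => D u v uv /=.
by rewrite !(po_classK uv) /= mulrDl.
Qed.

HB.instance Definition _ :=
  GRing.Zmodule_isComPzRing.Build po_ring po_mulA po_mulC po_mul1 po_mulDl.

End Pushout.

Lemma pushout_exists (k A B : comPzRingType) (f : {rmorphism k -> A})
    (g : {rmorphism k -> B}) :
  exists (P : comPzRingType) (u : {rmorphism A -> P}) (v : {rmorphism B -> P}),
  (forall c, u (f c) = v (g c)) /\
  forall (D : comPzRingType) (a : {rmorphism A -> D}) (b : {rmorphism B -> D}),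
    (forall c, a (f c) = b (g c)) ->
  exists! w : {rmorphism P -> D},
    (forall x, w (u x) = a x) /\ (forall y, w (v y) = b y).
Proof.
pose P : comPzRingType := po_ring f g.
have [u uE] : exists u : {rmorphism A -> P},
    forall a, u a = po_class f g (po_inl B a).
  apply: mk_rmorph => [x y|x y|//]; apply: po_eq_class => D a b ab /=;
    by rewrite !(po_classK ab) /= (rmorphD, rmorphM).
have [v vE] : exists v : {rmorphism B -> P},
    forall b, v b = po_class f g (po_inr A b).
  apply: mk_rmorph => [x y|x y|]; apply: po_eq_class => D a b ab /=;
    by rewrite ?(po_classK ab) /= ?(rmorphD, rmorphM, rmorph1).
exists P, u, v; split=> [c|D a b ab].
  by rewrite uE vE; apply: po_eq_class => D a b ab /=.
have [w wE] : exists w : {rmorphism P -> D},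
    forall x, w x = po_eval a b (po_repr x).
  apply: mk_rmorph => [x y|x y|]; by rewrite (po_classK ab) /= ?rmorph1.
exists w; split; first split.
- by move=> x; rewrite wE uE (po_classK ab).
- by move=> y; rewrite wE vE (po_classK ab).
move=> w' [w'u w'v]; apply: rmorph_ext => x.
rewrite wE -{2}[x]po_reprK; elim: (po_repr x) => /=.
- by move=> y; rewrite -uE w'u.
- by move=> y; rewrite -vE w'v.
- move=> s -> t ->; rewrite -rmorphD; congr (w' _).
  by apply: po_eq_class => E c d cd /=; rewrite !(po_classK cd).
- move=> s -> t ->; rewrite -rmorphM; congr (w' _).
  by apply: po_eq_class => E c d cd /=; rewrite !(po_classK cd).
Qed.

Record kscheme (k : comPzRingType) := KScheme {
  ks_sch :> scheme;
  ks_str : rmor ks_sch (Spec k) }.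

Arguments ks_str {k} _.

Section FibreProduct.

Variables (k : comPzRingType) (X Y : kscheme k).

Definition fp_obj (A : comPzRingType) : Type :=
  {p : X A * Y A | ks_str X A p.1 = ks_str Y A p.2}.

Lemma fp_ext (A : comPzRingType) (p q : fp_obj A) :
  (sval p).1 = (sval q).1 -> (sval p).2 = (sval q).2 -> p = q.
Proof.
case: p q => [[x y] hp] [[x' y'] hq] /= e1 e2; subst x' y'.
by rewrite (Prop_irrelevance hp hq).
Qed.

Lemma fp_map_subproof (A B : comPzRingType) (f : {rmorphism A -> B})
    (p : fp_obj A) :
  ks_str X B (rf_map f (sval p).1) = ks_str Y B (rf_map f (sval p).2).
Proof. by rewrite !rm_nat (svalP p). Qed.

Definition fp_map (A B : comPzRingType) (f : {rmorphism A -> B})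
    (p : fp_obj A) : fp_obj B :=
  exist _ (rf_map f (sval p).1, rf_map f (sval p).2) (fp_map_subproof f p).

Lemma fp_map_id (A : comPzRingType) (p : fp_obj A) : fp_map idfun p = p.
Proof. by apply: fp_ext; rewrite /= rf_id. Qed.

Lemma fp_map_comp (A B C : comPzRingType) (f : {rmorphism A -> B})
    (g : {rmorphism B -> C}) (p : fp_obj A) :
  fp_map (g \o f) p = fp_map g (fp_map f p).
Proof. by apply: fp_ext; rewrite /= rf_comp. Qed.

Definition fp_fun : rfunctor := RFunctor fp_map_id fp_map_comp.

Lemma fp_sheaf : is_zariski_sheaf fp_fun.
Proof.
move=> A n f B phi B2 l r uf lf lf2 lr z zz.
have [x [Hx Ux]] := sch_sheaf uf lf lf2 lr (x := fun i => (sval (z i)).1)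
  (fun i j => congr1 (fun p : fp_obj _ => (sval p).1) (zz i j)).
have [y [Hy Uy]] := sch_sheaf uf lf lf2 lr (x := fun i => (sval (z i)).2)
  (fun i j => congr1 (fun p : fp_obj _ => (sval p).2) (zz i j)).
have xy : ks_str X A x = ks_str Y A y.
  apply: rmorph_ext => c; apply: (localization_separated uf lf) => i.
  have : rf_map (phi i) (ks_str X A x) = rf_map (phi i) (ks_str Y A y).
    by rewrite -!rm_nat Hx Hy (svalP (z i)).
  by move/(congr1 (fun h : {rmorphism k -> B i} => h c)).
exists (exist _ (x, y) xy); split=> [i|z' Hz'].
  by apply: fp_ext => /=; rewrite ?Hx ?Hy.
by apply: fp_ext => /=; [apply: Ux | apply: Uy] => i; rewrite -Hz'.
Qed.

Lemma unit_ideal_products (A B : comPzRingType) (phi : {rmorphism A -> B})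
    (I J : A -> Prop) :
  generates_unit_ideal
    (fun b => exists2 a, (exists s t, [/\ I s, J t & a = s * t]) & b = phi a)
  <-> generates_unit_ideal (fun b => exists2 a, I a & b = phi a) /\
      generates_unit_ideal (fun b => exists2 a, J a & b = phi a).
Proof.
split=> [u|[uI uJ] K iK HK].
  split=> K iK HK; apply: u => // _ [_ [s [t [Is Jt ->]]] ->];
    have [_ _ KM] := iK; rewrite rmorphM.
    by rewrite mulrC; apply: KM; apply: HK; exists s.
  by apply: KM; apply: HK; exists t.
have [K0 KD KM] := iK.
apply: (uJ) => // _ [t Jt ->].
suff: K (1 * phi t) by rewrite mul1r.
apply: (uI (fun b => K (b * phi t))).
  split=> [|x y Kx Ky|a x Kx]; first by rewrite mul0r.
  - by rewrite mulrDl; apply: KD.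
  - by rewrite -mulrA; apply: (KM).
move=> _ [s Is ->]; apply: HK; exists (s * t); last by rewrite rmorphM.
by exists s, t.
Qed.

Lemma str_chart (Z : kscheme k) (R : comPzRingType) (j : rmor (Spec R) Z)
    (A : comPzRingType) (u : Spec R A) (c : k) :
  (ks_str Z A (j A u) : {rmorphism k -> A}) c =
  u ((ks_str Z R (j R idfun) : {rmorphism k -> R}) c).
Proof.
have e : u = rf_map u (idfun : Spec R R) by apply: rmorph_ext.
by rewrite {1}e !rm_nat.
Qed.

Lemma fp_chart (R S : comPzRingType) (i : rmor (Spec R) X)
    (j : rmor (Spec S) Y) :
  is_open_immersion i -> is_open_immersion j ->
  exists (P : comPzRingType) (h : rmor (Spec P) fp_fun),
  is_open_immersion h /\
  forall (A : comPzRingType) (p : fp_obj A), (exists w, h A w = p) <->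
    (exists u, i A u = (sval p).1) /\ (exists v, j A v = (sval p).2).
Proof.
move=> [i_inj i_op] [j_inj j_op].
have [P [u [v [uv Huv]]]] := pushout_exists
  (ks_str X R (i R idfun) : {rmorphism k -> R})
  (ks_str Y S (j S idfun) : {rmorphism k -> S}).
have h_ok (A : comPzRingType) (w : Spec P A) :
    ks_str X A (i A (w \o u : {rmorphism R -> A})) =
    ks_str Y A (j A (w \o v : {rmorphism S -> A})).
  apply: rmorph_ext => c.
  by rewrite (str_chart i (w \o u)) (str_chart j (w \o v)) /= uv.
pose h_fun A (w : Spec P A) : fp_fun A := exist _ (_, _) (h_ok A w).
have h_nat (A B : comPzRingType) (f : {rmorphism A -> B}) (w : Spec P A) :
    h_fun B (rf_map f w) = rf_map f (h_fun A w).
  by apply: fp_ext => /=; rewrite -rm_nat; congr (_ B _); apply: rmorph_ext.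
pose h : rmor (Spec P) fp_fun := RMor h_nat.
have h_im (A : comPzRingType) (p : fp_obj A) : (exists w, h A w = p) <->
    (exists u, i A u = (sval p).1) /\ (exists v, j A v = (sval p).2).
  split=> [[w <-]|[[a ap] [b bp]]]; first by split; eexists.
  have ab c : a ((ks_str X R (i R idfun) : {rmorphism k -> R}) c) =
              b ((ks_str Y S (j S idfun) : {rmorphism k -> S}) c).
    by rewrite -(str_chart i a) -(str_chart j b) ap bp (svalP p).
  have [w [[wu wv] _]] := Huv A a b ab.
  exists w; apply: fp_ext => /=.
    by rewrite -ap; congr (i A _); apply: rmorph_ext.
  by rewrite -bp; congr (j A _); apply: rmorph_ext.
exists P, h; split=> //; split=> [A w w' ww'|A p].
  have e1 : (w \o u : {rmorphism R -> A}) = (w' \o u).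
    exact: (i_inj A) (congr1 (fun p : fp_obj A => (sval p).1) ww').
  have e2 : (w \o v : {rmorphism S -> A}) = (w' \o v).
    exact: (j_inj A) (congr1 (fun p : fp_obj A => (sval p).2) ww').
  have [|w0 [_ U]] := Huv A (w \o u) (w \o v) _; first by move=> c /=; rewrite uv.
  rewrite -(U w) // (U w') //; split=> x /=.
    exact: (esym (congr1 (fun g : {rmorphism R -> A} => g x) e1)).
  exact: (esym (congr1 (fun g : {rmorphism S -> A} => g x) e2)).
have [I HI] := i_op A (sval p).1; have [J HJ] := j_op A (sval p).2.
exists (fun a => exists s t, [/\ I s, J t & a = s * t]) => B phi.
rewrite unit_ideal_products -HI -HJ; exact: (h_im B (fp_map phi p)).
Qed.

Lemma fp_cover : has_open_affine_cover fp_fun.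
Proof.
have [I [R [i [i_op i_cov]]]] := sch_cover X.
have [J [S [j [j_op j_cov]]]] := sch_cover Y.
pose chart (ij : I * J) (P : comPzRingType) (h : rmor (Spec P) fp_fun) :=
  is_open_immersion h /\
  forall (A : comPzRingType) (p : fp_obj A), (exists w, h A w = p) <->
    (exists u, i ij.1 A u = (sval p).1) /\ (exists v, j ij.2 A v = (sval p).2).
have [/= P HP] : {P : I * J -> comPzRingType &
    forall ij, exists h, chart ij (P ij) h}.
  apply: (choice (P := fun ij P => exists h, chart ij P h)) => -[a b].
  exact: fp_chart (i_op a) (j_op b).
pose h ij := projT1 (cid (HP ij)).
have hP ij : chart ij (P ij) (h ij) := projT2 (cid (HP ij)).
exists (I * J)%type, P, h; split=> [ij|K fK p]; first by have [] := hP ij.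
have [a xa] := i_cov K fK (sval p).1; have [b yb] := j_cov K fK (sval p).2.
by exists (a, b); have [_ ->] := hP (a, b).
Qed.

Definition fp_scheme : scheme := Scheme fp_sheaf fp_cover.

Definition fp_proj1 : rmor fp_scheme X :=
  @RMor fp_scheme X (fun A p => (sval p).1) (fun _ _ _ _ => erefl).

Definition fp_proj2 : rmor fp_scheme Y :=
  @RMor fp_scheme Y (fun A p => (sval p).2) (fun _ _ _ _ => erefl).

Definition fp : kscheme k := KScheme (rmor_comp (ks_str X) fp_proj1).

End FibreProduct.

Record category := Category {
  ob :> Type;
  hom : ob -> ob -> Type;
  idm : forall a, hom a a;
  comp : forall a b c, hom b c -> hom a b -> hom a c;
  comp_idl : forall a b (f : hom a b), comp (idm b) f = f;
  comp_idr : forall a b (f : hom a b), comp f (idm a) = f;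
  comp_assoc : forall a b c d (h : hom c d) (g : hom b c) (f : hom a b),
    comp h (comp g f) = comp (comp h g) f }.

Arguments hom {_} _ _.
Arguments idm {_} _.
Arguments comp {_ _ _ _} _ _.

Definition is_iso (D : category) (a b : D) (f : hom a b) : Prop :=
  exists g : hom b a, comp g f = idm a /\ comp f g = idm b.

Record kmor (k : comPzRingType) (X Y : kscheme k) := KMor {
  km_fun :> rmor X Y;
  km_str : forall (A : comPzRingType) (x : X A),
    ks_str Y A (km_fun A x) = ks_str X A x }.

Lemma kmor_ext (k : comPzRingType) (X Y : kscheme k) (f g : kmor X Y) :
  (forall A (x : X A), f A x = g A x) -> f = g.
Proof.
case: f g => [f sf] [g sg] /= /rmor_ext e; subst g.
by rewrite (Prop_irrelevance sf sg).
Qed.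

Definition kmor_id (k : comPzRingType) (X : kscheme k) : kmor X X :=
  @KMor k X X (rmor_id X) (fun _ _ => erefl).

Lemma kmor_comp_str (k : comPzRingType) (X Y Z : kscheme k) (g : kmor Y Z)
    (f : kmor X Y) (A : comPzRingType) (x : X A) :
  ks_str Z A (rmor_comp g f A x) = ks_str X A x.
Proof. by rewrite /= !km_str. Qed.

Definition kmor_comp (k : comPzRingType) (X Y Z : kscheme k) (g : kmor Y Z)
    (f : kmor X Y) : kmor X Z := KMor (kmor_comp_str g f).

Lemma kmor_comp_idl (k : comPzRingType) (X Y : kscheme k) (f : kmor X Y) :
  kmor_comp (kmor_id Y) f = f.
Proof. exact: kmor_ext. Qed.

Lemma kmor_comp_idr (k : comPzRingType) (X Y : kscheme k) (f : kmor X Y) :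
  kmor_comp f (kmor_id X) = f.
Proof. exact: kmor_ext. Qed.

Lemma kmor_comp_assoc (k : comPzRingType) (X Y Z W : kscheme k)
    (h : kmor Z W) (g : kmor Y Z) (f : kmor X Y) :
  kmor_comp h (kmor_comp g f) = kmor_comp (kmor_comp h g) f.
Proof. exact: kmor_ext. Qed.

Definition Sch (k : comPzRingType) : category :=
  @Category (kscheme k) (@kmor k) (@kmor_id k) (@kmor_comp k)
    (@kmor_comp_idl k) (@kmor_comp_idr k) (@kmor_comp_assoc k).

Section Products.

Variable k : comPzRingType.
Implicit Types T X W : kscheme k.

Definition pr1 T X : kmor (fp T X) T :=
  @KMor k (fp T X) T (fp_proj1 T X) (fun _ _ => erefl).

Definition pr2 T X : kmor (fp T X) X :=
  @KMor k (fp T X) X (fp_proj2 T X) (fun _ p => esym (svalP p)).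

Lemma pairing_ok W T X (f : kmor W T) (g : kmor W X) (A : comPzRingType)
    (w : W A) : ks_str T A (f A w) = ks_str X A (g A w).
Proof. by rewrite !km_str. Qed.

Definition pairing_fun W T X (f : kmor W T) (g : kmor W X)
    (A : comPzRingType) (w : W A) : fp T X A :=
  exist _ (f A w, g A w) (pairing_ok f g w).

Lemma pairing_nat W T X (f : kmor W T) (g : kmor W X)
    (A B : comPzRingType) (h : {rmorphism A -> B}) (w : W A) :
  pairing_fun f g (rf_map h w) = rf_map h (pairing_fun f g w).
Proof. by apply: fp_ext; rewrite /= rm_nat. Qed.

Definition pairing W T X (f : kmor W T) (g : kmor W X) : kmor W (fp T X) :=
  @KMor k W (fp T X) (RMor (pairing_nat f g)) (fun A w => km_str f w).

Lemma pr1_pairing W T X (f : kmor W T) (g : kmor W X) :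
  kmor_comp (pr1 T X) (pairing f g) = f.
Proof. exact: kmor_ext. Qed.

Lemma pr2_pairing W T X (f : kmor W T) (g : kmor W X) :
  kmor_comp (pr2 T X) (pairing f g) = g.
Proof. exact: kmor_ext. Qed.

Lemma pairing_unique W T X (h : kmor W (fp T X)) :
  h = pairing (kmor_comp (pr1 T X) h) (kmor_comp (pr2 T X) h).
Proof. by apply: kmor_ext => A w; apply: fp_ext. Qed.

Definition kmor_prod T X T' X' (f : kmor T T') (g : kmor X X') :
  kmor (fp T X) (fp T' X') :=
  pairing (kmor_comp f (pr1 T X)) (kmor_comp g (pr2 T X)).

Definition point : kscheme k :=
  @KScheme k (affine_scheme k) (rmor_id (Spec k)).

Definition to_point T : kmor T point :=
  @KMor k T point (ks_str T) (fun _ _ => erefl).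

End Products.

Record presheaf (D : category) := Presheaf {
  ps_obj :> D -> Type;
  ps_map : forall a b : D, hom b a -> ps_obj a -> ps_obj b;
  ps_id : forall (a : D) (x : ps_obj a), ps_map (idm a) x = x;
  ps_comp : forall (a b c : D) (f : hom b a) (g : hom c b) (x : ps_obj a),
    ps_map (comp f g) x = ps_map g (ps_map f x) }.

Record psmor (D : category) (F G : presheaf D) := PSMor {
  pm_fun :> forall a : D, F a -> G a;
  pm_nat : forall (a b : D) (f : hom b a) (x : F a),
    pm_fun (ps_map f x) = ps_map f (pm_fun x) }.

Lemma psmor_ext (D : category) (F G : presheaf D) (f g : psmor F G) :
  (forall a (x : F a), f a x = g a x) -> f = g.
Proof.
case: f g => [f nf] [g ng] /= e.
have e' : f = g by apply: functional_extensionality_dep => a; apply: funext.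
by subst g; rewrite (Prop_irrelevance nf ng).
Qed.

Lemma psmor_eq (D : category) (F G : presheaf D) (f g : psmor F G) :
  f = g -> forall a (x : F a), f a x = g a x.
Proof. by move=> ->. Qed.

Definition psmor_id (D : category) (F : presheaf D) : psmor F F :=
  @PSMor D F F (fun _ x => x) (fun _ _ _ _ => erefl).

Lemma psmor_comp_nat (D : category) (F G H : presheaf D) (g : psmor G H)
    (f : psmor F G) (a b : D) (h : hom b a) (x : F a) :
  g b (f b (ps_map h x)) = ps_map h (g a (f a x)).
Proof. by rewrite !pm_nat. Qed.

Definition psmor_comp (D : category) (F G H : presheaf D) (g : psmor G H)
    (f : psmor F G) : psmor F H := PSMor (psmor_comp_nat g f).

Definition psmor_iso (D : category) (F G : presheaf D) (f : psmor F G) : Prop :=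
  exists g : psmor G F,
    psmor_comp g f = psmor_id F /\ psmor_comp f g = psmor_id G.

Definition yoneda (D : category) (S : D) : presheaf D :=
  @Presheaf D (fun T => hom T S) (fun T T' f x => comp x f)
    (fun T x => comp_idr x) (fun a b c f g x => comp_assoc x f g).

Lemma ps_prod_id (D : category) (F G : presheaf D) (a : D) (p : F a * G a) :
  (ps_map (idm a) p.1, ps_map (idm a) p.2) = p.
Proof. by case: p => x y; rewrite /= !ps_id. Qed.

Lemma ps_prod_comp (D : category) (F G : presheaf D) (a b c : D)
    (f : hom b a) (g : hom c b) (p : F a * G a) :
  (ps_map (comp f g) p.1, ps_map (comp f g) p.2) =
  (ps_map g (ps_map f p.1), ps_map g (ps_map f p.2)).
Proof. by rewrite !ps_comp. Qed.

Definition ps_prod (D : category) (F G : presheaf D) : presheaf D :=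
  @Presheaf D (fun a => (F a * G a)%type)
    (fun a b f p => (ps_map f p.1, ps_map f p.2))
    (@ps_prod_id D F G) (@ps_prod_comp D F G).

Definition ps_pr1 (D : category) (F G : presheaf D) : psmor (ps_prod F G) F :=
  @PSMor D (ps_prod F G) F (fun _ p => p.1) (fun _ _ _ _ => erefl).

Section FibreProductPresheaf.

Variables (D : category) (H' H F : presheaf D).
Variables (h : psmor H' H) (f : psmor F H).

Definition psfp_obj (a : D) : Type := {p : H' a * F a | h a p.1 = f a p.2}.

Lemma psfp_ext (a : D) (p q : psfp_obj a) :
  (sval p).1 = (sval q).1 -> (sval p).2 = (sval q).2 -> p = q.
Proof.
case: p q => [[x y] hp] [[x' y'] hq] /= e1 e2; subst x' y'.
by rewrite (Prop_irrelevance hp hq).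
Qed.

Lemma psfp_map_subproof (a b : D) (g : hom b a) (p : psfp_obj a) :
  h b (ps_map g (sval p).1) = f b (ps_map g (sval p).2).
Proof. by rewrite !pm_nat (svalP p). Qed.

Definition psfp_map (a b : D) (g : hom b a) (p : psfp_obj a) : psfp_obj b :=
  exist _ (ps_map g (sval p).1, ps_map g (sval p).2) (psfp_map_subproof g p).

Lemma psfp_id (a : D) (p : psfp_obj a) : psfp_map (idm a) p = p.
Proof. by apply: psfp_ext; rewrite /= ps_id. Qed.

Lemma psfp_comp (a b c : D) (g : hom b a) (g' : hom c b) (p : psfp_obj a) :
  psfp_map (comp g g') p = psfp_map g' (psfp_map g p).
Proof. by apply: psfp_ext; rewrite /= ps_comp. Qed.

Definition psfp : presheaf D := Presheaf psfp_id psfp_comp.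

Definition psfp_pr1 : psmor psfp H' :=
  @PSMor D psfp H' (fun a p => (sval p).1) (fun _ _ _ _ => erefl).

End FibreProductPresheaf.

Record grp_functor (D : category) := GrpFunctor {
  gf_fun :> presheaf D;
  gf_one : forall a, gf_fun a;
  gf_mul : forall a, gf_fun a -> gf_fun a -> gf_fun a;
  gf_inv : forall a, gf_fun a -> gf_fun a;
  gf_mulA : forall a, associative (@gf_mul a);
  gf_mul1 : forall a, left_id (gf_one a) (@gf_mul a);
  gf_mulV : forall a, left_inverse (gf_one a) (@gf_inv a) (@gf_mul a);
  gf_map_mul : forall (a b : D) (f : hom b a) (x y : gf_fun a),
    ps_map f (gf_mul x y) = gf_mul (ps_map f x) (ps_map f y) }.

Record grp_iso (D : category) (G G' : grp_functor D) := GrpIso {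
  gi_mor :> psmor G G';
  gi_iso : psmor_iso gi_mor;
  gi_mul : forall (a : D) (x y : G a),
    gi_mor a (gf_mul x y) = gf_mul (gi_mor a x) (gi_mor a y) }.

Lemma psmor_id_iso (D : category) (F : presheaf D) : psmor_iso (psmor_id F).
Proof. by exists (psmor_id F); split; apply: psmor_ext. Qed.

Lemma psmor_comp_iso (D : category) (F G H : presheaf D) (g : psmor G H)
    (f : psmor F G) :
  psmor_iso g -> psmor_iso f -> psmor_iso (psmor_comp g f).
Proof.
move=> [g' [g'g gg']] [f' [f'f ff']]; exists (psmor_comp f' g').
split; apply: psmor_ext => a x /=.
  by rewrite [g' _ _](psmor_eq g'g) [LHS](psmor_eq f'f).
by rewrite [f _ _](psmor_eq ff') [LHS](psmor_eq gg').
Qed.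

Definition grp_iso_id (D : category) (G : grp_functor D) : grp_iso G G :=
  @GrpIso D G G (psmor_id G) (psmor_id_iso G) (fun _ _ _ => erefl).

Lemma grp_iso_comp_mul (D : category) (G G' G'' : grp_functor D)
    (g : grp_iso G' G'') (f : grp_iso G G') (a : D) (x y : G a) :
  g a (f a (gf_mul x y)) = gf_mul (g a (f a x)) (g a (f a y)).
Proof. by rewrite !gi_mul. Qed.

Definition grp_iso_comp (D : category) (G G' G'' : grp_functor D)
    (g : grp_iso G' G'') (f : grp_iso G G') : grp_iso G G'' :=
  @GrpIso D G G'' (psmor_comp g f) (psmor_comp_iso (gi_iso g) (gi_iso f))
    (grp_iso_comp_mul g f).

(** A functorial construction of a presheaf from a group functor, up to
    isomorphism of group functors: such a presheaf depends only on the group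
    functor structure. *)
Record grp_construction (D : category) := GrpConstruction {
  gc_obj :> grp_functor D -> presheaf D;
  gc_map : forall G G' : grp_functor D,
    grp_iso G G' -> psmor (gc_obj G) (gc_obj G');
  gc_id : forall G, gc_map (grp_iso_id G) = psmor_id (gc_obj G);
  gc_comp : forall (G G' G'' : grp_functor D) (g : grp_iso G' G'')
    (f : grp_iso G G'),
    gc_map (grp_iso_comp g f) = psmor_comp (gc_map g) (gc_map f) }.

Section Aut.

Variables (k : comPzRingType) (X : kscheme k).
Implicit Types T : kscheme k.

Definition is_aut_over T (f : kmor (fp T X) (fp T X)) : Prop :=
  kmor_comp (pr1 T X) f = pr1 T X /\ @is_iso (Sch k) (fp T X) (fp T X) f.

Definition aut_obj T : Type := {f : kmor (fp T X) (fp T X) | is_aut_over f}.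

Lemma aut_ext T (f g : aut_obj T) :
  (forall A p, (sval f) A p = (sval g) A p) -> f = g.
Proof.
case: f g => [f hf] [g hg] /= e.
have {}e : f = g by apply: kmor_ext.
subst g.
by rewrite (Prop_irrelevance hf hg).
Qed.

Lemma is_aut_over_pr1 T (f : kmor (fp T X) (fp T X)) :
  is_aut_over f -> forall A p, (sval (f A p)).1 = (sval p).1.
Proof.
by move=> [e _] A p; exact: (congr1 (fun g : kmor (fp T X) T => g A p) e).
Qed.

Lemma is_aut_over_inv T (f : kmor (fp T X) (fp T X)) : is_aut_over f ->
  exists g, [/\ is_aut_over g, kmor_comp g f = kmor_id _
             & kmor_comp f g = kmor_id _].
Proof.
move=> [e [g [gf fg]]]; exists g; split=> //; split; last by exists f.
rewrite -{1}e -[LHS](@comp_assoc (Sch k) (fp T X) (fp T X) (fp T X) T).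
by rewrite fg comp_idr.
Qed.

(** The pullback of [f] along [h : T' -> T], under [T' x_T (T x X) = T' x X]. *)
Definition aut_pull T T' (h : kmor T' T) (f : kmor (fp T X) (fp T X)) :
  kmor (fp T' X) (fp T' X) :=
  pairing (pr1 T' X)
    (kmor_comp (pr2 T X) (kmor_comp f (kmor_prod h (kmor_id X)))).

Lemma aut_pull_comp T T' (h : kmor T' T) (f g : kmor (fp T X) (fp T X)) :
  is_aut_over g ->
  aut_pull h (kmor_comp f g) = kmor_comp (aut_pull h f) (aut_pull h g).
Proof.
move=> hg; apply: kmor_ext => A p; apply: fp_ext => //=.
congr (sval (f A _)).2; apply: fp_ext => //=.
by rewrite (is_aut_over_pr1 hg).
Qed.

Lemma aut_pull_id T T' (h : kmor T' T) :
  aut_pull h (kmor_id (fp T X)) = kmor_id (fp T' X).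
Proof. by apply: kmor_ext => A p; apply: fp_ext. Qed.

Lemma aut_pull_ok T T' (h : kmor T' T) (f : kmor (fp T X) (fp T X)) :
  is_aut_over f -> is_aut_over (aut_pull h f).
Proof.
move=> hf; have [g [hg gf fg]] := is_aut_over_inv hf.
split; first exact: kmor_ext.
exists (aut_pull h g); split; rewrite [LHS]/comp /= -aut_pull_comp //.
  by rewrite gf aut_pull_id.
by rewrite fg aut_pull_id.
Qed.

Definition aut_map T T' (h : kmor T' T) (f : aut_obj T) : aut_obj T' :=
  exist _ (aut_pull h (sval f)) (aut_pull_ok h (svalP f)).

Lemma aut_map_id T (f : aut_obj T) : aut_map (kmor_id T) f = f.
Proof.
apply: aut_ext => A p /=; apply: fp_ext => /=.
  by rewrite (is_aut_over_pr1 (svalP f)).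
by congr (sval ((sval f) A _)).2; apply: fp_ext.
Qed.

Lemma aut_map_comp T T' T'' (h : kmor T' T) (h' : kmor T'' T')
    (f : aut_obj T) : aut_map (kmor_comp h h') f = aut_map h' (aut_map h f).
Proof.
apply: aut_ext => A p; apply: fp_ext => //=.
by congr (sval ((sval f) A _)).2; apply: fp_ext.
Qed.

Definition aut_fun : presheaf (Sch k) :=
  @Presheaf (Sch k) aut_obj aut_map aut_map_id aut_map_comp.

Lemma aut_one_ok T : is_aut_over (kmor_id (fp T X)).
Proof.
split; first exact: kmor_ext.
by exists (kmor_id (fp T X)); split; apply: kmor_ext.
Qed.

Definition aut_one T : aut_obj T := exist _ (kmor_id (fp T X)) (aut_one_ok T).

Lemma aut_mul_ok T (f g : aut_obj T) :
  is_aut_over (kmor_comp (sval f) (sval g)).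
Proof.
have [f' [_ f'f ff']] := is_aut_over_inv (svalP f).
have [g' [_ g'g gg']] := is_aut_over_inv (svalP g).
have e (Y Y' : kscheme k) (s t : kmor Y Y') : s = t ->
    forall A x, s A x = t A x by move=> ->.
split.
  apply: kmor_ext => A p /=.
  by rewrite (is_aut_over_pr1 (svalP f)) (is_aut_over_pr1 (svalP g)).
exists (kmor_comp g' f'); split; apply: kmor_ext => A p.
  rewrite -[RHS](e _ _ _ _ g'g A p); congr (g' A _).
  exact: (e _ _ _ _ f'f A).
rewrite -[RHS](e _ _ _ _ ff' A p); congr (sval f A _).
exact: (e _ _ _ _ gg' A).
Qed.

Definition aut_mul T (f g : aut_obj T) : aut_obj T :=
  exist _ (kmor_comp (sval f) (sval g)) (aut_mul_ok f g).

Definition aut_inv T (f : aut_obj T) : aut_obj T :=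
  let g := cid (is_aut_over_inv (svalP f)) in
  exist _ (projT1 g) (let: And3 ok _ _ := projT2 g in ok).

Lemma aut_mulA T : associative (@aut_mul T).
Proof. by move=> f g h; apply: aut_ext. Qed.

Lemma aut_mul1 T : left_id (aut_one T) (@aut_mul T).
Proof. by move=> f; apply: aut_ext. Qed.

Lemma aut_mulV T : left_inverse (aut_one T) (@aut_inv T) (@aut_mul T).
Proof.
move=> f; apply: aut_ext => A p; rewrite /aut_inv /=.
case: cid => g /= [_ gf _].
exact: (congr1 (fun h : kmor _ _ => h A p) gf).
Qed.

Lemma aut_map_mul T T' (h : kmor T' T) (f g : aut_obj T) :
  aut_map h (aut_mul f g) = aut_mul (aut_map h f) (aut_map h g).
Proof.
apply: aut_ext => A p.
exact: (congr1 (fun s : kmor _ _ => s A p)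
  (aut_pull_comp h (sval f) (svalP g))).
Qed.

Definition Aut : grp_functor (Sch k) :=
  @GrpFunctor (Sch k) aut_fun aut_one aut_mul aut_inv
    aut_mulA aut_mul1 aut_mulV aut_map_mul.

End Aut.

Section RestrictBase.

Variables (k l : comPzRingType) (iota : {rmorphism k -> l}).

Definition restr (T : kscheme l) : kscheme k :=
  @KScheme k T (rmor_comp (Spec_mor iota) (ks_str T)).

Lemma restr_mor_str (T T' : kscheme l) (f : kmor T T') (A : comPzRingType)
    (x : T A) : ks_str (restr T') A (f A x) = ks_str (restr T) A x.
Proof. by rewrite /= km_str. Qed.

Definition restr_mor (T T' : kscheme l) (f : kmor T T') :
  kmor (restr T) (restr T') := @KMor k (restr T) (restr T') f (restr_mor_str f).

Lemma ps_restr_id (H : presheaf (Sch k)) (T : kscheme l)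
    (x : H (restr T)) :
  @ps_map _ H (restr T) (restr T) (restr_mor (kmor_id T)) x = x.
Proof.
have -> : restr_mor (kmor_id T) = kmor_id (restr T) by apply: kmor_ext.
exact: (@ps_id _ H (restr T)).
Qed.

Lemma ps_restr_comp (H : presheaf (Sch k)) (T T' T'' : kscheme l)
    (f : kmor T' T) (g : kmor T'' T') (x : H (restr T)) :
  @ps_map _ H (restr T) (restr T'') (restr_mor (kmor_comp f g)) x =
  @ps_map _ H (restr T') (restr T'') (restr_mor g)
    (@ps_map _ H (restr T) (restr T') (restr_mor f) x).
Proof.
have -> : restr_mor (kmor_comp f g) = kmor_comp (restr_mor f) (restr_mor g).
  exact: kmor_ext.
exact: (@ps_comp _ H (restr T) (restr T') (restr T'')).
Qed.

Definition ps_restr (H : presheaf (Sch k)) : presheaf (Sch l) :=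
  @Presheaf (Sch l) (fun T => H (restr T))
    (fun T T' f x => @ps_map _ H (restr T) (restr T') (restr_mor f) x)
    (@ps_restr_id H) (@ps_restr_comp H).

Definition psmor_restr (H H' : presheaf (Sch k)) (f : psmor H H') :
  psmor (ps_restr H) (ps_restr H') :=
  @PSMor (Sch l) (ps_restr H) (ps_restr H') (fun T x => f (restr T) x)
    (fun T T' g x => pm_nat f (restr_mor g : @hom (Sch k) (restr T') (restr T)) x).

End RestrictBase.

Section Real.

Variable R : realType.

Definition R_to_C : {rmorphism R -> R[i]} := real_complex R.

Definition RScheme := kscheme R.
Definition CScheme := kscheme R[i].
Definition FR := presheaf (Sch R).
Definition FC := presheaf (Sch R[i]).

Definition as_real (T : CScheme) : RScheme := restr R_to_C T.

Definition complexify (H : FR) : FC := ps_restr R_to_C H.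

Definition complexify_mor (H H' : FR) (f : psmor H H') :
  psmor (complexify H) (complexify H') := psmor_restr R_to_C f.

Definition point_functor (X : RScheme) : FR := @yoneda (Sch R) X.

Definition prod_with (H : FR) (X : RScheme) : FR := ps_prod H (point_functor X).

Definition SpecR : RScheme := point R.
Definition SpecC : CScheme := point R[i].

Lemma conj_real (A : comPzRingType) (x : as_real SpecC A) :
  ks_str (as_real SpecC) A (Spec_mor (@conjc R) A x) =
  ks_str (as_real SpecC) A x.
Proof. by apply: rmorph_ext => c /=; rewrite oppr0. Qed.

Definition tau : kmor (as_real SpecC) (as_real SpecC) :=
  @KMor R (as_real SpecC) (as_real SpecC) (Spec_mor (@conjc R)) conj_real.

(** [base_C S] is [S_C] viewed as an R-scheme, [scheme_C S] as a C-scheme. *)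
Definition base_C (S : RScheme) : RScheme := fp S (as_real SpecC).

Definition scheme_C (S : RScheme) : CScheme :=
  @KScheme R[i] (base_C S) (pr2 S (as_real SpecC)).

Definition sigma (S : RScheme) : kmor (base_C S) (base_C S) :=
  kmor_prod (kmor_id S) tau.

Lemma sigmaK (S : RScheme) :
  kmor_comp (sigma S) (sigma S) = kmor_id (base_C S).
Proof.
apply: kmor_ext => A p; apply: fp_ext => //.
by apply: rmorph_ext => c /=; rewrite conjcK.
Qed.

(** The pair [(H', theta)] is a real form of [H]. *)
Definition is_real_form (H H' : FR)
    (theta : psmor (complexify H') (complexify H)) : Prop :=
  psmor_iso theta.

(** A 1-cocycle of [Gal(C/R)] in [Aut_C(X_C)] is given by the image [Psi] of the
    nontrivial element. The second [sigma X] stands for its inverse, see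
    [sigmaK]; the equation holds in automorphisms of the scheme [X_C]. *)
Definition is_cocycle (X : RScheme)
    (Psi : kmor (scheme_C X) (scheme_C X)) : Prop :=
  @is_iso (Sch R[i]) (scheme_C X) (scheme_C X) Psi /\
  rmor_comp (sigma X) (rmor_comp Psi (rmor_comp (sigma X) Psi)) =
  rmor_id (base_C X).

Definition cocycles (X : RScheme) : Type :=
  {Psi : kmor (scheme_C X) (scheme_C X) | is_cocycle Psi}.

Definition swap (X : RScheme) : kmor (base_C X) (fp (as_real SpecC) X) :=
  pairing (pr2 X (as_real SpecC)) (pr1 X (as_real SpecC)).

Record relative_form (X : RScheme) (H : FR) := RelativeForm {
  rel_total :> presheaf (Sch R);
  rel_proj : psmor rel_total H;
  rel_triv : psmor (complexify rel_total) (complexify (prod_with H X));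
  rel_triv_iso : psmor_iso rel_triv;
  rel_over : complexify_mor rel_proj =
    psmor_comp (complexify_mor (ps_pr1 H (point_functor X))) rel_triv }.

Definition relative_form_iso (X : RScheme) (H : FR) (F F' : relative_form X H)
    : Prop :=
  exists xi : psmor F' F,
    [/\ psmor_iso xi, rel_proj F' = psmor_comp (rel_proj F) xi &
        rel_triv F' = psmor_comp (rel_triv F) (complexify_mor xi)].

Section BaseChange.

Variables (X : RScheme) (H H' : FR) (F : relative_form X H) (h : psmor H' H).

Definition bc_total : FR := psfp h (rel_proj F).

Definition bc_triv_fun (T : CScheme) (p : complexify bc_total T) :
    complexify (prod_with H' X) T :=
  ((sval p).1, (rel_triv F T (sval p).2).2).

Lemma bc_triv_nat (T T' : CScheme) (f : @hom (Sch R[i]) T' T)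
    (p : complexify bc_total T) :
  bc_triv_fun (ps_map f p) = ps_map f (bc_triv_fun p).
Proof. by rewrite /bc_triv_fun /= (pm_nat (rel_triv F)). Qed.

Definition bc_triv :
    psmor (complexify bc_total) (complexify (prod_with H' X)) :=
  @PSMor (Sch R[i]) (complexify bc_total) (complexify (prod_with H' X))
    bc_triv_fun bc_triv_nat.

Lemma bc_triv_iso : psmor_iso bc_triv.
Proof.
have over (T : CScheme) (x : complexify F T) :
    rel_proj F (as_real T) x = (rel_triv F T x).1.
  exact: (@psmor_eq (Sch R[i]) _ _ _ _ (rel_over F) T).
have [g [gt tg]] := rel_triv_iso F.
have gtE (T : CScheme) x : g T (rel_triv F T x) = x.
  exact: (@psmor_eq (Sch R[i]) _ _ _ _ gt T).
have tgE (T : CScheme) x : rel_triv F T (g T x) = x.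
  exact: (@psmor_eq (Sch R[i]) _ _ _ _ tg T).
have inv_ok (T : CScheme) (q : complexify (prod_with H' X) T) :
    h (as_real T) q.1 =
    rel_proj F (as_real T) (g T (h (as_real T) q.1, q.2)).
  by rewrite over tgE.
pose inv_fun (T : CScheme) (q : complexify (prod_with H' X) T) :
  complexify bc_total T := exist _ (_, _) (inv_ok T q).
have inv_nat (T T' : CScheme) (f : @hom (Sch R[i]) T' T)
    (q : complexify (prod_with H' X) T) :
    inv_fun T' (ps_map f q) = ps_map f (inv_fun T q).
  apply: psfp_ext => //=; rewrite -[RHS](pm_nat g); congr (g T' (_, _)).
  by rewrite pm_nat.
exists (@PSMor (Sch R[i]) (complexify (prod_with H' X)) (complexify bc_total)
  inv_fun inv_nat); split; apply: psmor_ext => T q.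
  apply: psfp_ext => //=.
  rewrite (svalP q) over -[RHS]gtE; congr (g T _).
  by case: (rel_triv F T _).
by rewrite /= /bc_triv_fun /= tgE; case: q.
Qed.

Lemma bc_over : complexify_mor (psfp_pr1 h (rel_proj F)) =
  psmor_comp (complexify_mor (ps_pr1 H' (point_functor X))) bc_triv.
Proof. exact: psmor_ext. Qed.

Definition base_change : relative_form X H' := RelativeForm bc_triv_iso bc_over.

End BaseChange.

(** The sheaf condition for the Galois covering [T_C -> T]: [F(T)] is the set of
    Galois-invariant elements of [F(T_C)]. It is not automatic, even if [F] is
    the total space of a relative form: [F_C] does not determine the values of
    [F] on R-schemes that are not C-schemes. *)
Definition galois_descent (F : FR) : Prop :=
  forall T : RScheme,
  (forall s t : F T,
    @ps_map _ F T (base_C T) (pr1 T (as_real SpecC)) s =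
    @ps_map _ F T (base_C T) (pr1 T (as_real SpecC)) t -> s = t) /\
  (forall y : F (base_C T),
    @ps_map _ F (base_C T) (base_C T) (sigma T) y = y ->
    exists s : F T, @ps_map _ F T (base_C T) (pr1 T (as_real SpecC)) s = y).

End Real.

(* Main.v *)
Require Import Defs.
From HB Require Import structures.
From mathcomp Require Import all_boot ssralg ssrnum.
From mathcomp Require Import boolp classical_sets reals complex.
From mathcomp Require Import ring.

Set Implicit Arguments.
Unset Strict Implicit.
Unset Printing Implicit Defensive.

Import GRing.Theory.
Local Open Scope ring_scope.

(** A real scheme is a complex scheme with an involution, and over a complex
    scheme [T] the covering [T_C -> T] splits: [T_C] is the disjoint union of
    the locus where its two complex structures coincide and the locus where
    they are conjugate, both copies of [T]. Let [Z(T)] be the set of [z] in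
    [Aut(T_C)] with [sigma^*z z = 1]. Over a complex [T], restriction to the
    first copy is a bijection [Z(T) -> Aut(T)], since the cocycle equation
    determines [z] on the second copy as the inverse. Let [U(T)] be the set of
    pairs [(z, x)] with [z] in [Z(T)], [x] in [X(T_C)] and [z x = sigma^*x].
    For a relative form [F] over [S], comparing the trivializations over
    [S_C] and over its complex conjugate gives a point of [Z(S)], and Galois
    descent for [F] identifies [F] with the pullback of [U] along it; the
    component in [S] descends because [T_C -> T] is an epimorphism. *)

(** * Rings of fractions and residue fields *)

Section Fractions.

Variables (A : comPzRingType) (M J : A -> Prop).
Hypotheses (M1 : M 1) (MM : forall s t, M s -> M t -> M (s * t)).
Hypothesis iJ : is_ideal J.

Record fraction := Fraction { num : A; den : A; den_ok : M den }.

(** Equality in the localization at [M] of the quotient of [A] by [J]. Taking [J = 0] gives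
    localizations and [M = {1}] gives quotients, so one construction serves both. *)
Definition frac_eq (x y : fraction) : Prop :=
  exists2 u, M u & J (u * (den y * num x - den x * num y)).

Lemma frac_refl x : frac_eq x x.
Proof. by have [J0 _ _] := iJ; exists 1 => //; rewrite subrr mulr0. Qed.

Lemma frac_sym x y : frac_eq x y -> frac_eq y x.
Proof.
have [_ _ JM] := iJ; case=> u uM e; exists u => //.
by rewrite -opprB mulrN -mulN1r; apply: JM.
Qed.

Lemma frac_trans x y z : frac_eq x y -> frac_eq y z -> frac_eq x z.
Proof.
have [_ JD JM] := iJ; case: x y z => [a s hs] [b t ht] [c w hw].
(* The middle denominator [t] enters the witness because eliminating the middle numerator multiplies
   the outer difference by it. *)
case=> /= u uM e [/= v vM e']; exists (t * (u * v)); first by do !apply: MM.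
have := JD _ _ (JM (v * w) _ e) (JM (u * s) _ e').
by congr J => /=; ring.
Qed.

Definition fractions : Type :=
  {P : fraction -> Prop | exists x, P = frac_eq x}.

Definition frac_class (x : fraction) : fractions :=
  exist _ (frac_eq x) (ex_intro _ x erefl).

Definition frac_repr (q : fractions) : fraction := projT1 (cid (proj2_sig q)).

Lemma frac_class_eq x y : frac_eq x y -> frac_class x = frac_class y.
Proof.
move=> xy; apply: eq_exist; apply: funext => z; apply: propext; split.
  exact/frac_trans/frac_sym.
exact: frac_trans.
Qed.

Lemma frac_class_inj x y : frac_class x = frac_class y -> frac_eq x y.
Proof. by case=> ->; apply: frac_refl. Qed.

Lemma frac_reprK q : frac_class (frac_repr q) = q.
Proof.
case: q => P hP; apply: eq_exist; rewrite /frac_repr /=.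
by case: cid => x /= ->.
Qed.

Lemma frac_classP q : exists x, q = frac_class x.
Proof. by exists (frac_repr q); rewrite frac_reprK. Qed.

Lemma frac_repr_class x : frac_eq (frac_repr (frac_class x)) x.
Proof. exact/frac_class_inj/frac_reprK. Qed.

Definition frac_add x y :=
  Fraction (den y * num x + den x * num y) (MM (den_ok x) (den_ok y)).
Definition frac_mul x y :=
  Fraction (num x * num y) (MM (den_ok x) (den_ok y)).
Definition frac_opp x := Fraction (- num x) (den_ok x).
Definition frac_inj a := Fraction a M1.

Lemma frac_add_eq x x' y y' :
  frac_eq x x' -> frac_eq y y' -> frac_eq (frac_add x y) (frac_add x' y').
Proof.
have [_ JD JM] := iJ.
case: x x' y y' => [a s hs] [a' s' hs'] [b t ht] [b' t' ht'].
case=> /= u uM e [/= v vM e']; exists (u * v); first exact: MM.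
have := JD _ _ (JM (v * t * t') _ e) (JM (u * s * s') _ e').
by congr J => /=; ring.
Qed.

Lemma frac_mul_eq x x' y y' :
  frac_eq x x' -> frac_eq y y' -> frac_eq (frac_mul x y) (frac_mul x' y').
Proof.
have [_ JD JM] := iJ.
case: x x' y y' => [a s hs] [a' s' hs'] [b t ht] [b' t' ht'].
case=> /= u uM e [/= v vM e']; exists (u * v); first exact: MM.
have := JD _ _ (JM (v * t' * b) _ e) (JM (u * s * a') _ e').
by congr J => /=; ring.
Qed.

Lemma frac_opp_eq x x' : frac_eq x x' -> frac_eq (frac_opp x) (frac_opp x').
Proof.
have [_ _ JM] := iJ; case: x x' => [a s hs] [a' s' hs'] [/= u uM e].
by exists u => //; have := JM (-1) _ e; congr J => /=; ring.
Qed.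

HB.instance Definition _ := gen_eqMixin fractions.
HB.instance Definition _ := gen_choiceMixin fractions.

Definition fracs_add q r := frac_class (frac_add (frac_repr q) (frac_repr r)).
Definition fracs_mul q r := frac_class (frac_mul (frac_repr q) (frac_repr r)).
Definition fracs_opp q := frac_class (frac_opp (frac_repr q)).

Lemma fracs_addE x y :
  fracs_add (frac_class x) (frac_class y) = frac_class (frac_add x y).
Proof. by apply/frac_class_eq/frac_add_eq; apply: frac_repr_class. Qed.

Lemma fracs_mulE x y :
  fracs_mul (frac_class x) (frac_class y) = frac_class (frac_mul x y).
Proof. by apply/frac_class_eq/frac_mul_eq; apply: frac_repr_class. Qed.

Lemma fracs_oppE x : fracs_opp (frac_class x) = frac_class (frac_opp x).
Proof. by apply/frac_class_eq/frac_opp_eq; apply: frac_repr_class. Qed.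

Lemma frac_class_cross x y :
  den y * num x = den x * num y -> frac_class x = frac_class y.
Proof.
have [J0 _ _] := iJ => e; apply: frac_class_eq; exists 1 => //.
by rewrite e subrr mulr0.
Qed.

Lemma fracs_addA : associative fracs_add.
Proof.
move=> q r s; case: (frac_classP q) (frac_classP r) (frac_classP s).
move=> x -> [y ->] [z ->]; rewrite !fracs_addE.
by apply: frac_class_cross => /=; ring.
Qed.

Lemma fracs_addC : commutative fracs_add.
Proof.
move=> q r; case: (frac_classP q) (frac_classP r) => x -> [y ->].
by rewrite !fracs_addE; apply: frac_class_cross => /=; ring.
Qed.

Lemma fracs_add0 : left_id (frac_class (frac_inj 0)) fracs_add.
Proof.
move=> q; case: (frac_classP q) => x ->.
by rewrite fracs_addE; apply: frac_class_cross => /=; ring.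
Qed.

Lemma fracs_addN :
  left_inverse (frac_class (frac_inj 0)) fracs_opp fracs_add.
Proof.
move=> q; case: (frac_classP q) => x ->.
by rewrite fracs_oppE fracs_addE; apply: frac_class_cross => /=; ring.
Qed.

HB.instance Definition _ :=
  GRing.isZmodule.Build fractions fracs_addA fracs_addC fracs_add0 fracs_addN.

Lemma fracs_mulA : associative fracs_mul.
Proof.
move=> q r s; case: (frac_classP q) (frac_classP r) (frac_classP s).
move=> x -> [y ->] [z ->]; rewrite !fracs_mulE.
by apply: frac_class_cross => /=; ring.
Qed.

Lemma fracs_mulC : commutative fracs_mul.
Proof.
move=> q r; case: (frac_classP q) (frac_classP r) => x -> [y ->].
by rewrite !fracs_mulE; apply: frac_class_cross => /=; ring.
Qed.

Lemma fracs_mul1 : left_id (frac_class (frac_inj 1)) fracs_mul.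
Proof.
move=> q; case: (frac_classP q) => x ->.
by rewrite fracs_mulE; apply: frac_class_cross => /=; ring.
Qed.

Lemma fracs_mulDl : left_distributive fracs_mul fracs_add.
Proof.
move=> q r s; case: (frac_classP q) (frac_classP r) (frac_classP s).
move=> x -> [y ->] [z ->]; rewrite !(fracs_addE, fracs_mulE).
by apply: frac_class_cross => /=; ring.
Qed.

HB.instance Definition _ := GRing.Zmodule_isComPzRing.Build fractions
  fracs_mulA fracs_mulC fracs_mul1 fracs_mulDl.

Lemma fractions_exist :
  exists (B : comPzRingType) (phi : {rmorphism A -> B}),
  [/\ forall s, M s -> exists t, phi s * t = 1,
      forall b, exists a s, M s /\ b * phi s = phi a &
      forall a, phi a = 0 <-> exists2 s, M s & J (s * a)].
Proof.
have [phi phiE] : exists phi : {rmorphism A -> fractions},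
    forall a, phi a = frac_class (frac_inj a).
  apply: mk_rmorph => [a b|a b|//].
    rewrite [RHS]fracs_addE; apply: frac_class_cross => /=; ring.
  rewrite [RHS]fracs_mulE; apply: frac_class_cross => /=; ring.
exists fractions, phi; split.
- move=> s sM; exists (frac_class (Fraction 1 sM)).
  by rewrite phiE [LHS]fracs_mulE; apply: frac_class_cross => /=; ring.
- move=> q; case: (frac_classP q) => -[a s sM] ->; exists a, s; split=> //.
  by rewrite !phiE [LHS]fracs_mulE; apply: frac_class_cross => /=; ring.
- move=> a; rewrite phiE -[0]/(frac_class (frac_inj 0)); split.
    move=> /frac_class_inj [s sM /= e]; exists s => //.
    by move: e; rewrite mulr0 subr0 mul1r.
  case=> s sM e; apply: frac_class_eq; exists s => //=.
  by rewrite mulr0 subr0 mul1r.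
Qed.

End Fractions.

Lemma zero_ideal (A : comPzRingType) : is_ideal (fun a : A => a = 0).
Proof.
split=> [//|x y -> ->|a x ->]; [exact: addr0 | exact: mulr0].
Qed.

Lemma localization_exists (A : comPzRingType) (f : A) :
  exists (B : comPzRingType) (phi : {rmorphism A -> B}), is_localization phi f.
Proof.
pose M s := exists n, s = f ^+ n.
have M1 : M 1 by exists 0%N.
have MM s t : M s -> M t -> M (s * t).
  by move=> [m ->] [n ->]; exists (m + n)%N; rewrite exprD.
have [B [phi [Hu Hf H0]]] := fractions_exist M1 MM (@zero_ideal A).
exists B, phi; split.
- by apply: Hu; exists 1%N; rewrite expr1.
- move=> b; have [a [_ [[n ->] e]]] := Hf b.
  by exists a, n; rewrite -e rmorphXn.
- by move=> a /H0 [_ [n ->] e]; exists n.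
Qed.

Lemma quotient_exists (A : comPzRingType) (J : A -> Prop) : is_ideal J ->
  exists (B : comPzRingType) (phi : {rmorphism A -> B}),
  (forall b, exists a, b = phi a) /\ forall a, phi a = 0 <-> J a.
Proof.
move=> iJ.
have MM (s t : A) : s = 1 -> t = 1 -> s * t = 1 by move=> -> ->; rewrite mulr1.
have [B [phi [_ Hf H0]]] := fractions_exist (M := fun s => s = 1) erefl MM iJ.
exists B, phi; split=> [b|a].
  by have [a [_ [-> e]]] := Hf b; exists a; rewrite -e rmorph1 mulr1.
rewrite H0; split=> [[_ -> ]|Ja]; first by rewrite mul1r.
by exists 1; rewrite ?mul1r.
Qed.

(** The value at [b] is read off a chosen presentation of [b] as a fraction. By [kE] every
    presentation gives the same value, so additivity and multiplicativity follow by presenting sums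
    and products. *)
Lemma localization_lift (A B D : comPzRingType) (phi : {rmorphism A -> B})
    (f : A) (h : {rmorphism A -> D}) :
  is_localization phi f -> (exists g, h f * g = 1) ->
  exists k : {rmorphism B -> D}, forall a, k (phi a) = h a.
Proof.
move=> lf [g fg]; have [_ lfr lz] := lf.
have fgn n : h f ^+ n * g ^+ n = 1 by rewrite -exprMn fg expr1n.
have [/= p Hp] : {p : B -> A * nat & forall b,
    b * phi f ^+ (p b).2 = phi (p b).1}.
  apply: (choice (P := fun b p => b * phi f ^+ p.2 = phi p.1)) => b.
  by have [a [n e]] := lfr b; exists (a, n).
pose k b := h (p b).1 * g ^+ (p b).2.
have kE b a n : b * phi f ^+ n = phi a -> k b = h a * g ^+ n.
  move=> e; have /lz [m Hm] : phi (f ^+ n * (p b).1 - f ^+ (p b).2 * a) = 0.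
    by rewrite rmorphB !rmorphM -e -Hp !rmorphXn; ring.
  have : h f ^+ m * (h f ^+ n * h (p b).1 - h f ^+ (p b).2 * h a) = 0.
    by rewrite -!rmorphXn -!rmorphM -rmorphB -rmorphM Hm rmorph0.
  move/(congr1 (fun d => g ^+ m * (g ^+ n * (g ^+ (p b).2 * d)))).
  rewrite !mulr0 /k => e0; apply/eqP; rewrite -subr_eq0 -[X in _ == X]e0.
  apply/eqP; transitivity ((h f ^+ m * g ^+ m) * ((h f ^+ n * g ^+ n) *
    (h (p b).1 * g ^+ (p b).2) - (h f ^+ (p b).2 * g ^+ (p b).2) *
    (h a * g ^+ n))); last by ring.
  by rewrite !fgn; ring.
have [k' k'E] : exists k' : {rmorphism B -> D}, forall b, k' b = k b.
  apply: mk_rmorph.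
  - move=> b c; rewrite (kE _ ((p b).1 * f ^+ (p c).2 + (p c).1 * f ^+ (p b).2)
      ((p b).2 + (p c).2)%N).
      rewrite rmorphD !rmorphM !rmorphXn exprD /k.
      transitivity ((h f ^+ (p c).2 * g ^+ (p c).2) * (h (p b).1 * g ^+ (p b).2)
        + (h f ^+ (p b).2 * g ^+ (p b).2) * (h (p c).1 * g ^+ (p c).2)).
        by ring.
      by rewrite !fgn; ring.
    by rewrite rmorphD !rmorphM -!Hp !rmorphXn exprD; ring.
  - move=> b c; rewrite (kE _ ((p b).1 * (p c).1) ((p b).2 + (p c).2)%N).
      by rewrite rmorphM exprD /k; ring.
    by rewrite rmorphM -!Hp exprD; ring.
  - by rewrite (kE 1 1 0%N) ?rmorph1 ?mulr1.
exists k' => a; rewrite k'E (kE _ a 0%N); last by rewrite mulr1.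
by rewrite mulr1.
Qed.

(** * Locality of points of a scheme *)

Lemma zero_ring_point (X : scheme) (A : comPzRingType) (x y : X A) :
  1 = 0 :> A -> x = y.
Proof.
move=> e.
have no P : forall i : 'I_0, P i by move=> [].
(* Over the zero ring the empty family is a covering, and its gluing problem has exactly one
   solution. *)
have [z [_ U]] := @sch_sheaf X A 0%N (fun=> 0) (fun=> A)
  (fun=> idfun) (fun _ _ => A) (fun _ _ => idfun) (fun _ _ => idfun)
  ltac:(by move=> J [J0 _ _] _; rewrite e) ltac:(exact: no) ltac:(exact: no)
  ltac:(exact: no) ltac:(exact: no) ltac:(exact: no).
by transitivity z; [apply/esym/U | apply/U]; apply: no.
Qed.

(** Supplies the overlaps that the sheaf condition takes as data. *)
Lemma localizations_exist (A : comPzRingType) (n : nat) (f : 'I_n -> A)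
    (B : 'I_n -> comPzRingType) (phi : forall i, {rmorphism A -> B i}) :
  (forall i, is_localization (phi i) (f i)) ->
  exists (B2 : 'I_n -> 'I_n -> comPzRingType)
    (l : forall i j, {rmorphism B i -> B2 i j})
    (r : forall i j, {rmorphism B j -> B2 i j}),
  (forall i j, is_localization (l i j \o phi i) (f i * f j)) /\
  forall i j a, l i j (phi i a) = r i j (phi j a).
Proof.
move=> lf.
pose ok i j (C : comPzRingType) (l : {rmorphism B i -> C})
    (r : {rmorphism B j -> C}) :=
  is_localization (l \o phi i) (f i * f j) /\
  forall a, l (phi i a) = r (phi j a).
have H i j : exists C l r, @ok i j C l r.
  have [C [psi lpsi]] := localization_exists (f i * f j).
  have [[g fg] _ _] := lpsi.
  have [|l lE] := localization_lift (h := psi) (lf i).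
    by exists (psi (f j) * g); rewrite mulrA -rmorphM.
  have [|r rE] := localization_lift (h := psi) (lf j).
    by exists (psi (f i) * g); rewrite mulrA -rmorphM (mulrC (f j)).
  exists C, l, r; split=> [|a]; last by rewrite lE rE.
  have -> : l \o phi i = psi :> {rmorphism A -> C} by exact: rmorph_ext.
  by [].
pose c i j := cid (H i j); pose d i j := cid (projT2 (c i j)).
pose e i j := cid (projT2 (d i j)).
exists (fun i j => projT1 (c i j)), (fun i j => projT1 (d i j)),
  (fun i j => projT1 (e i j)).
by split=> i j; have [] := projT2 (e i j).
Qed.

(** An expression of [1] involves only finitely many elements of [J]; the sheaf condition is stated
    for finite coverings. *)
Lemma unit_ideal_finite (A : comPzRingType) (J : A -> Prop) :
  generates_unit_ideal J ->
  exists n (f : 'I_n -> A), (forall i, J (f i)) /\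
    generates_unit_ideal (fun a => exists i, a = f i).
Proof.
move=> uJ.
(* [K] is the union of the ideals generated by finite lists from [J], such an ideal being described
   as the intersection of all ideals that contain the list. *)
pose K a := exists s : seq A, (forall x, x \in s -> J x) /\
  forall I, is_ideal I -> (forall x, x \in s -> I x) -> I a.
have [|x Jx|s [sJ s1]] := uJ K.
- split=> [|x y [s [sJ sx]] [t [tJ ty]]|a x [s [sJ sx]]].
  + by exists [::]; split=> // I [].
  + exists (s ++ t); split=> [z|I iI stI].
      by rewrite mem_cat => /orP[/sJ|/tJ].
    have [_ ID _] := iI; apply: ID; [apply: sx|apply: ty];
      move=> // z zs; apply: stI; by rewrite mem_cat zs ?orbT.
  + exists s; split=> // I iI sI; have [_ _ IM] := iI.
    by apply: (IM); apply: sx.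
- exists [:: x]; split=> [y|I iI]; first by rewrite inE => /eqP ->.
  by apply; rewrite inE.
exists (size s), (fun i => tnth (in_tuple s) i); split=> [i|I iI HI].
  exact/sJ/mem_tnth.
apply: s1 => // x xs.
have /tnthP[i xi] : x \in in_tuple s by [].
by apply: HI; exists i.
Qed.

(** A finite part of the covering is extracted, and the uniqueness half of the sheaf condition is
    applied to the restrictions of [x]. *)
Lemma scheme_separated (X : scheme) (A : comPzRingType) (J : A -> Prop)
    (x y : X A) :
  generates_unit_ideal J ->
  (forall f, J f -> exists (B : comPzRingType) (phi : {rmorphism A -> B}),
    is_localization phi f /\ rf_map phi x = rf_map phi y) ->
  x = y.
Proof.
move=> /unit_ideal_finite [n [f [Jf uf]]] H.
pose c i := cid (H _ (Jf i)); pose d i := cid (projT2 (c i)).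
have lf i : is_localization (projT1 (d i)) (f i) by case: (projT2 (d i)).
have xy i : rf_map (projT1 (d i)) x = rf_map (projT1 (d i)) y.
  by case: (projT2 (d i)).
have [B2 [l [r [lf2 lr]]]] := localizations_exist lf.
have [|z [_ U]] := sch_sheaf uf lf lf2 lr
    (x := fun i => rf_map (projT1 (d i)) x).
  move=> i j; rewrite -!rf_comp; congr (rf_map _ x).
  by apply: rmorph_ext => a; exact: lr.
by transitivity z; [apply/esym/U | apply/U].
Qed.

(** * Maximal ideals and residue fields *)

Definition proper_over (A : comPzRingType) (J I : A -> Prop) :=
  [/\ is_ideal I, ~ I 1 & forall x, J x -> I x].

Lemma ideal_adjoin (A : comPzRingType) (I : A -> Prop) (a : A) :
  is_ideal I -> is_ideal (fun x => exists2 b, I (x - b * a) & True).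
Proof.
move=> [I0 ID IM]; split.
- by exists 0; rewrite // mul0r subr0.
- move=> x y [b Ib _] [c Ic _]; exists (b + c) => //.
  by have := ID _ _ Ib Ic; congr I; ring.
- move=> d x [b Ib _]; exists (d * b) => //.
  by have := IM d _ Ib; congr I; ring.
Qed.

Lemma maximal_ideal_exists (A : comPzRingType) (J : A -> Prop) :
  ~ generates_unit_ideal J ->
  exists I, proper_over J I /\
    forall a, ~ I a -> exists b, I (1 - b * a).
Proof.
move=> nJ.
have [I0 [i0 JI0 n0]] : exists I, [/\ is_ideal I, forall x, J x -> I x & ~ I 1].
  apply: contrapT => nI; apply: nJ => I iI JI; apply: contrapT => n1.
  by apply: nI; exists I.
pose P : set (set A) := fun I => I = set0 \/ proper_over J I.
have [I [PI mI]] : exists I, P I /\ forall K, (I `<` K)%classic -> ~ P K.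
  apply: Zorn_bigcup => F FP tot.
  have [[K0 [FK0 pK0]]|nF] :=
    pselect (exists K, F K /\ proper_over J K); last first.
    left; apply/seteqP; split=> // x [K FK Kx]; have [K0|pK] := FP _ FK.
      by rewrite K0 in Kx.
    by apply: nF; exists K.
  have pF K x : F K -> K x -> proper_over J K.
    by move=> FK Kx; have [K0'|//] := FP _ FK; rewrite K0' in Kx.
  have [[z0 _ _] n01 J0] := pK0.
  right; split.
  - split=> [|x y [K FK Kx] [L FL Ly]|a x [K FK Kx]].
    + by exists K0.
    + have [KL|LK] := tot _ _ FK FL.
        exists L => //; have [[_ + _] _ _] := pF _ _ FL Ly.
        by apply=> //; apply: KL.
      exists K => //; have [[_ + _] _ _] := pF _ _ FK Kx.
      by apply=> //; apply: LK.
    + by exists K => //; have [[_ _ +] _ _] := pF _ _ FK Kx; apply.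
  - by move=> [K FK K1]; have [_ + _] := pF _ _ FK K1; apply.
  - by move=> x Jx; exists K0 => //; apply: J0.
have pI : proper_over J I.
  (* The proper ideal [I0] shows that the empty set is not maximal in [P]. *)
  case: PI => // I_0; exfalso; apply: (mI I0); last by right.
  split; first by rewrite I_0.
  by move=> /(_ 0); rewrite I_0; apply; case: i0.
exists I; split=> // a Ia; apply: contrapT => nb.
have [iI I1 JI] := pI; have [z ID IM] := iI.
(* If [a] were not invertible modulo [I], then [I + (a)] would be a strictly larger proper ideal. *)
apply: (mI (fun x => exists2 b, I (x - b * a) & True)).
  split=> [x Ix|/(_ a) H]; first by exists 0 => //; rewrite mul0r subr0.
  by apply/Ia/H; exists 1; rewrite ?mul1r ?subrr.
right; split; first exact: ideal_adjoin.
  by case=> b Ib _; apply: nb; exists b.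
by move=> x /JI Ix; exists 0 => //; rewrite mul0r subr0.
Qed.

(** Otherwise the residue field at a maximal ideal containing [J] would send all of [J] to zero. *)
Lemma unit_ideal_by_fields (A : comPzRingType) (J : A -> Prop) :
  (forall (K : comPzRingType) (phi : {rmorphism A -> K}), is_field K ->
    exists2 a, J a & phi a <> 0) ->
  generates_unit_ideal J.
Proof.
move=> H; apply: contrapT => /maximal_ideal_exists [I [[iI I1 JI] mI]].
have [K [phi [sphi phi0]]] := quotient_exists iI.
have fK : is_field K.
  split=> [e|x]; first by apply/I1/phi0; rewrite rmorph1.
  have [a -> /phi0] := sphi x.
  rewrite -/(not _) => /mI [b Ib]; exists (phi b).
  move/phi0: Ib; rewrite rmorphB rmorph1 rmorphM mulrC => /eqP.
  by rewrite subr_eq0 => /eqP.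
by have [a /JI /phi0] := H K phi fK.
Qed.

(** * Gluing along an idempotent *)

(** The elements [e] and [1 - e] cover the spectrum of [A] by two disjoint open subschemes, so [x]
    and [y] glue without a compatibility condition. *)
Lemma glue_idempotent (X : scheme) (A : comPzRingType) (e : A) (x y : X A) :
  e * e = e ->
  exists z : X A, forall (D : comPzRingType) (h : {rmorphism A -> D}),
    (h e = 1 -> rf_map h z = rf_map h x) /\
    (h e = 0 -> rf_map h z = rf_map h y).
Proof.
move=> ee.
pose f (i : 'I_2) : A := if i == ord0 then e else 1 - e.
pose w (i : 'I_2) : X A := if i == ord0 then x else y.
have uf : generates_unit_ideal (fun a => exists i, a = f i).
  move=> J [_ JD _] Jf; have -> : 1 = f ord0 + f ord_max.
    by rewrite /f /=; ring.
  by apply: JD; apply: Jf; eexists.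
have ff i j : i != j -> f i * f j = 0.
  rewrite /f; case: i j => [[|[|//]] hi] [[|[|//]] hj] //= _.
    by rewrite mulrBr mulr1 ee subrr.
  by rewrite mulrBl mul1r ee subrr.
pose c i := cid (localization_exists (f i)); pose d i := cid (projT2 (c i)).
pose phi i := projT1 (d i).
have lf i : is_localization (phi i) (f i) := projT2 (d i).
have [B2 [l [r [lf2 lr]]]] := localizations_exist lf.
have [|z [zw _]] := sch_sheaf uf lf lf2 lr (x := fun i => rf_map (phi i) (w i)).
  move=> i j; rewrite -!rf_comp.
  have -> : (r i j \o phi j : {rmorphism A -> B2 i j}) = l i j \o phi i.
    by apply: rmorph_ext => a /=; rewrite lr.
  (* The overlap of two distinct pieces is the spectrum of the zero ring. *)
  have [->//|ij] := eqVneq i j; apply: zero_ring_point.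
  by have [[g <-] _ _] := lf2 i j; rewrite ff // rmorph0 mul0r.
have factor i (D : comPzRingType) (h : {rmorphism A -> D}) :
    h (f i) = 1 -> rf_map h z = rf_map h (w i).
  move=> h1; have [|k kE] := localization_lift (h := h) (lf i).
    by exists 1; rewrite h1 mulr1.
  have -> : h = k \o phi i by apply: rmorph_ext => a /=; rewrite kE.
  by rewrite !rf_comp zw.
exists z => D h; split=> he; first exact: (factor ord0).
by apply: (factor ord_max); rewrite /f /= rmorphB rmorph1 he subr0.
Qed.

Lemma separated_idempotent (X : scheme) (A : comPzRingType) (e : A)
    (x y : X A) :
  e * e = e ->
  (forall (D : comPzRingType) (h : {rmorphism A -> D}),
    h e = 1 \/ h e = 0 -> rf_map h x = rf_map h y) ->
  x = y.
Proof.
move=> ee H.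
(* In its own localization an idempotent is invertible, hence equal to [1]. *)
have unit1 (f : A) (B : comPzRingType) (phi : {rmorphism A -> B}) :
    f * f = f -> is_localization phi f -> phi f = 1.
  move=> ff [[g fg] _ _]; rewrite -[LHS]mulr1 -[in LHS]fg mulrA -rmorphM ff.
  exact: fg.
apply: (scheme_separated (J := fun a => a = e \/ a = 1 - e)).
  move=> J [_ JD _] Je; have -> : 1 = e + (1 - e) by ring.
  by apply: JD; apply: Je; [left|right].
have ee' : (1 - e) * (1 - e) = 1 - e by rewrite mulrBl mul1r mulrBr ee; ring.
move=> f Hf; have [B [phi lphi]] := localization_exists f; exists B, phi.
split=> //; apply: H.
case: Hf lphi => -> lphi; first by left; apply: unit1 lphi.
right; have := unit1 _ _ _ ee' lphi; rewrite rmorphB rmorph1 => e1.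
by have -> : phi e = 1 - (1 - phi e); [ring | rewrite e1 subrr].
Qed.

(** * Pairs of complex structures on a real algebra *)

Section ComplexPoints.

Variable R : realType.

Definition conjC : {rmorphism R[i] -> R[i]} := @conjc R.

Definition same_real (A : comPzRingType) (u v : {rmorphism R[i] -> A}) : Prop :=
  forall a : R, u (R_to_C R a) = v (R_to_C R a).

Lemma complex_point_ext (A : comPzRingType) (u v : {rmorphism R[i] -> A}) :
  same_real u v -> u 'i%C = v 'i%C -> u = v.
Proof.
move=> uv ui; apply: rmorph_ext => z.
by rewrite [z]complexE !rmorphD !rmorphM ui (uv (Re z)) (uv (Im z)).
Qed.

Lemma comp_conj_i (A : comPzRingType) (v : {rmorphism R[i] -> A}) :
  (v \o conjC : {rmorphism R[i] -> A}) 'i%C = - v 'i%C.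
Proof.
rewrite -rmorphN -[LHS]/(v (conjC 'i%C)); congr (v _).
by apply/eqP; rewrite eq_complex /= oppr0 !eqxx.
Qed.

Lemma i_sq : 'i%C * 'i%C = -1 :> R[i].
Proof. by rewrite -expr2 sqr_i. Qed.

(** [coincidence u v] is the idempotent that is [1] where [u = v] and [0] where
    [u] is the conjugate of [v]. *)
Definition coincidence (A : comPzRingType) (u v : {rmorphism R[i] -> A}) : A :=
  (1 - u 'i%C * v 'i%C) * u (R_to_C R 2%:R^-1).

Lemma half_image (A : comPzRingType) (u : {rmorphism R[i] -> A}) :
  u (R_to_C R 2%:R^-1) + u (R_to_C R 2%:R^-1) = 1.
Proof.
have e : 2%:R^-1 + 2%:R^-1 = 1 :> R by rewrite [RHS]Num.Theory.splitr mul1r.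
by rewrite -!rmorphD e !rmorph1.
Qed.

Lemma sq_image_i (A : comPzRingType) (u : {rmorphism R[i] -> A}) :
  u 'i%C * u 'i%C = -1.
Proof. by rewrite -rmorphM i_sq rmorphN rmorph1. Qed.

Lemma coincidence_idem (A : comPzRingType) (u v : {rmorphism R[i] -> A}) :
  coincidence u v * coincidence u v = coincidence u v.
Proof.
rewrite /coincidence; set h := u (R_to_C R _).
have hh : h + h = 1 := half_image u.
set a := u _; set b := v _.
have aa : a * a = -1 := sq_image_i u.
have bb : b * b = -1 := sq_image_i v.
transitivity ((1 - a * b - a * b + (a * a) * (b * b)) * h * h); first by ring.
rewrite aa bb; transitivity ((1 - a * b) * h * (h + h)); first by ring.
by rewrite hh mulr1.
Qed.

(** Doubling removes the factor 1/2, so the value [1] means u(i)v(i) = -1; as v(i) squares to -1,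
    this amounts to u(i) = v(i). *)
Lemma coincidence1 (A : comPzRingType) (u v : {rmorphism R[i] -> A}) :
  same_real u v -> coincidence u v = 1 <-> u = v.
Proof.
move=> uv; have hh := half_image u.
have aa := sq_image_i u; have bb := sq_image_i v.
rewrite /coincidence; set h := u (R_to_C R _) in hh *.
split=> [e|<-]; last by rewrite aa opprK mulrDl mul1r.
have ab : u 'i%C * v 'i%C = 1 - (1 - u 'i%C * v 'i%C) * h * (1 + 1).
  transitivity (1 - (1 - u 'i%C * v 'i%C) * (h + h)); last by ring.
  by rewrite hh; ring.
apply: complex_point_ext => //.
transitivity (- (u 'i%C * (v 'i%C * v 'i%C))); first by rewrite bb; ring.
by rewrite mulrA ab e; ring.
Qed.

(** Here the value [0] means u(i)v(i) = 1, that is, u(i) = -v(i). *)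
Lemma coincidence0 (A : comPzRingType) (u v : {rmorphism R[i] -> A}) :
  same_real u v -> coincidence u v = 0 <-> u = v \o conjC.
Proof.
move=> uv; have hh := half_image u.
have aa := sq_image_i u; have bb := sq_image_i v.
rewrite /coincidence; set h := u (R_to_C R _) in hh *.
split=> [e|uE]; last first.
  have -> : v 'i%C = - u 'i%C.
    by rewrite uE comp_conj_i opprK.
  by rewrite mulrN aa opprK subrr mul0r.
have ab : u 'i%C * v 'i%C = 1 - (1 - u 'i%C * v 'i%C) * h * (1 + 1).
  transitivity (1 - (1 - u 'i%C * v 'i%C) * (h + h)); last by ring.
  by rewrite hh; ring.
apply: complex_point_ext => [a|].
  by rewrite uv /=; congr (v _); apply/eqP; rewrite eq_complex /= oppr0 !eqxx.
rewrite comp_conj_i.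
transitivity (- (u 'i%C * (v 'i%C * v 'i%C))); first by rewrite bb; ring.
by rewrite mulrA ab e; ring.
Qed.

Lemma coincidence_map (A B : comPzRingType) (u v : {rmorphism R[i] -> A})
    (h : {rmorphism A -> B}) :
  h (coincidence u v) = coincidence (h \o u) (h \o v).
Proof. by rewrite /coincidence rmorphM rmorphB rmorph1 rmorphM. Qed.

(** [T_C] is the disjoint union of two copies of a complex scheme [T], the
    loci where its two complex structures coincide resp. are conjugate: a
    function on it is given by one on each locus. *)
Definition glues (X : scheme) (A : comPzRingType) (u v : {rmorphism R[i] -> A})
    (x y z : X A) : Prop :=
  forall (B : comPzRingType) (h : {rmorphism A -> B}),
    (h \o u = h \o v :> {rmorphism R[i] -> B} -> rf_map h z = rf_map h x) /\
    (h \o u = h \o (v \o conjC) :> {rmorphism R[i] -> B} ->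
      rf_map h z = rf_map h y).

Lemma conj_split_separated (X : scheme) (A : comPzRingType)
    (u v : {rmorphism R[i] -> A}) (x y : X A) :
  same_real u v ->
  (forall (B : comPzRingType) (h : {rmorphism A -> B}),
    h \o u = h \o v :> {rmorphism R[i] -> B} \/
    h \o u = h \o (v \o conjC) :> {rmorphism R[i] -> B} ->
    rf_map h x = rf_map h y) ->
  x = y.
Proof.
move=> uv H; apply: (separated_idempotent (coincidence_idem u v)) => B h.
have huv : same_real (h \o u) (h \o v) by move=> a /=; rewrite uv.
rewrite coincidence_map coincidence1 // coincidence0 // => he; apply: H.
by case: he => e; [left|right; rewrite e; apply: rmorph_ext].
Qed.

Lemma glue_exists (X : scheme) (A : comPzRingType)
    (u v : {rmorphism R[i] -> A}) (x y : X A) :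
  same_real u v -> exists z, glues u v x y z.
Proof.
move=> uv; have [z Hz] := glue_idempotent x y (coincidence_idem u v).
exists z => B h; have [H1 H0] := Hz B h.
have huv : same_real (h \o u) (h \o v) by move=> a /=; rewrite uv.
split=> e; [apply: H1|apply: H0]; rewrite coincidence_map.
  exact/coincidence1.
by apply/coincidence0 => //; rewrite e; apply: rmorph_ext.
Qed.

Lemma glues_unique (X : scheme) (A : comPzRingType)
    (u v : {rmorphism R[i] -> A}) (x y z z' : X A) :
  same_real u v -> glues u v x y z -> glues u v x y z' -> z = z'.
Proof.
move=> uv gz gz'; apply: (conj_split_separated uv) => B h.
have [h1 h2] := gz B h; have [h1' h2'] := gz' B h.
by case=> e; [rewrite h1 // h1' | rewrite h2 // h2'].
Qed.

End ComplexPoints.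

(** * The covering [T_C -> T] is an epimorphism *)

(** The pair (a, b) stands for a + bi, so this is A[t]/(t^2 + 1). *)
Definition gauss (A : comPzRingType) : Type := (A * A)%type.

Section Gauss.

Variable A : comPzRingType.

HB.instance Definition _ := GRing.Zmodule.copy (gauss A) (A * A)%type.

Definition gauss_mul (z w : gauss A) : gauss A :=
  (z.1 * w.1 - z.2 * w.2, z.1 * w.2 + z.2 * w.1).

Lemma gauss_mulA : associative gauss_mul.
Proof. by move=> x y z; congr (_, _) => /=; ring. Qed.

Lemma gauss_mulC : commutative gauss_mul.
Proof. by move=> x y; congr (_, _) => /=; ring. Qed.

Lemma gauss_mul1 : left_id ((1, 0) : gauss A) gauss_mul.
Proof. by move=> [a b]; congr (_, _) => /=; ring. Qed.

Lemma gauss_mulDl : left_distributive gauss_mul (fun z w => z + w).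
Proof. by move=> x y z; congr (_, _) => /=; ring. Qed.

HB.instance Definition _ := GRing.Zmodule_isComPzRing.Build (gauss A)
  gauss_mulA gauss_mulC gauss_mul1 gauss_mulDl.

End Gauss.

(** The ring [B] is the tensor product of [A] with the complex numbers over the reals. It is free
    over [A] with basis 1, i, which makes [phi] injective and lets unit ideals descend. *)
Lemma adjoin_i_exists (R : realType) (A : comPzRingType)
    (r : {rmorphism R -> A}) :
  exists (B : comPzRingType) (phi : {rmorphism A -> B})
    (c : {rmorphism R[i] -> B}),
  [/\ forall a, c (R_to_C R a) = phi (r a), injective phi &
      forall I : A -> Prop,
        generates_unit_ideal (fun b => exists2 a, I a & b = phi a) ->
        generates_unit_ideal I].
Proof.
have [phi phiE] : exists phi : {rmorphism A -> gauss A},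
    forall a, phi a = (a, 0).
  apply: mk_rmorph => [a b|a b|//]; congr (_, _) => /=; ring.
have [c cE] : exists c : {rmorphism R[i] -> gauss A},
    forall z, c z = (r (Re z), r (Im z)).
  apply: mk_rmorph => [[a b] [a' b']|[a b] [a' b']|] /=.
  - by congr (_, _); rewrite rmorphD.
  - by congr (_, _) => /=; rewrite (rmorphB, rmorphD) !rmorphM.
  - by rewrite rmorph0 rmorph1.
exists (gauss A), phi, c; split.
- by move=> a; rewrite cE phiE /= rmorph0.
- by move=> a b; rewrite !phiE => -[].
move=> I uI J [J0 JD JM] IJ.
(* The ideal [J] extends to the ideal J + Ji of A[i], which contains [1] only if [J] does. *)
have [] // := uI (fun z => J z.1 /\ J z.2); last first.
  by move=> _ [a Ia ->]; rewrite phiE; split => //=; apply: IJ.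
split=> [//|x y [Jx Jx'] [Jy Jy']|a x [Jx Jx']].
  by split; apply: JD.
have JB u v : J u -> J v -> J (u - v).
  by move=> Ju Jv; rewrite -mulN1r; apply: JD => //; apply: JM.
by split; [apply: JB|apply: JD]; apply: JM.
Qed.

(** Adjoining i is faithfully flat, so it detects equality of points. Inside an affine chart this is
    injectivity of the extension by i; in general one localizes [A] until both points lie in a
    common chart. *)
Lemma scheme_points_descend (R : realType) (X : scheme) (A : comPzRingType)
    (r : {rmorphism R -> A}) (x y : X A) :
  (forall (B : comPzRingType) (h : {rmorphism A -> B})
    (c : {rmorphism R[i] -> B}),
    (forall a, c (R_to_C R a) = h (r a)) -> rf_map h x = rf_map h y) ->
  x = y.
Proof.
move=> H.
apply: (scheme_separated (J := fun f => exists (B : comPzRingType)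
  (phi : {rmorphism A -> B}),
  is_localization phi f /\ rf_map phi x = rf_map phi y)) => //.
apply: unit_ideal_by_fields => K phi fK.
have [I [D [j [j_op j_cov]]]] := sch_cover X.
have [i [u ux]] := j_cov K fK (rf_map phi x).
have [j_inj j_open] := j_op i.
have [Ix HIx] := j_open A x; have [Iy HIy] := j_open A y.
(* The chart through the image of [x] over [K] contains [x] on the neighbourhood where some [a],
   nonzero in [K], is inverted. *)
have [a Ia pa] : exists2 a, Ix a & phi a <> 0.
  apply: contrapT => na; have [K1 _] := fK; apply: K1.
  have /HIx uK : exists u, j i K u = rf_map phi x by exists u.
  apply: (uK _ (@zero_ideal K)).
  by move=> _ [a Ia ->]; apply: contrapT => pa; apply: na; exists a.
exists a => //.
have [B [psi lpsi]] := localization_exists a; exists B, psi; split=> //.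
have [v vx] : exists v, j i B v = rf_map psi x.
  apply/HIx => J [_ _ JM] HJ; have [[g <-] _ _] := lpsi.
  by rewrite mulrC; apply/JM/HJ; exists a.
have [C [chi [c [cE chi_inj chi_unit]]]] := adjoin_i_exists (psi \o r).
have xy : rf_map chi (rf_map psi x) = rf_map chi (rf_map psi y).
  by rewrite -!rf_comp; apply: (H _ _ c).
(* After adjoining i the two points agree, so [y] lies in the chart there and [Iy] generates the
   unit ideal; this descends to [B]. *)
have [w wy] : exists w, j i B w = rf_map psi y.
  apply/HIy; apply: chi_unit.
  have [_ uC] := HIy C (chi \o psi); have [uC' _] := HIy C (chi \o psi).
  have /uC' uy : exists w, j i C w = rf_map (chi \o psi) y.
    by exists (rf_map chi v); rewrite rm_nat vx xy rf_comp.
  move=> J iJ HJ; apply: uy => // _ [b Ib ->]; apply: HJ.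
  by exists (psi b) => //; exists b.
have vw : rf_map chi v = rf_map chi w.
  by apply: (j_inj C); rewrite !rm_nat vx wy.
rewrite -vx -wy; congr (j i B _); apply: rmorph_ext => d; apply: chi_inj.
exact: (congr1 (fun h : {rmorphism D i -> C} => h d) vw).
Qed.

(** Over an algebra with a complex structure [c], a point [t] of [T] lifts to the point [(t, c)] of
    the covering, and such algebras suffice to separate points of [S]. *)
Lemma base_C_epi (R : realType) (T S : RScheme R) (p q : kmor T S) :
  kmor_comp p (pr1 T (as_real (SpecC R))) =
    kmor_comp q (pr1 T (as_real (SpecC R))) ->
  p = q.
Proof.
move=> pq; apply: kmor_ext => A t.
apply: (scheme_points_descend (r := ks_str T A t)) => B h c ch.
have tc : ks_str T B (rf_map h t) = ks_str (as_real (SpecC R)) B c.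
  by rewrite rm_nat; apply: rmorph_ext => a /=; rewrite -ch.
have := congr1 (fun f : kmor (base_C T) S => f B
  (exist _ (rf_map h t, c) tc : base_C T B)) pq.
by rewrite /= !rm_nat.
Qed.

(** * The twisted form [Z] *)

Section Groups.

Variables (D : category) (G : grp_functor D) (a : D).
Implicit Types x y : G a.

Lemma gf_idem_one x : gf_mul x x = x -> x = gf_one G a.
Proof. by move=> xx; rewrite -[LHS]gf_mul1 -(gf_mulV x) -gf_mulA xx. Qed.

(** The axioms give left inverses only; this product is idempotent, and the only idempotent of a
    group is the unit. *)
Lemma gf_mulgV x : gf_mul x (gf_inv x) = gf_one G a.
Proof.
apply: gf_idem_one.
by rewrite -gf_mulA [gf_mul (gf_inv x) _]gf_mulA gf_mulV gf_mul1.
Qed.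

Lemma gf_mulg1 x : gf_mul x (gf_one G a) = x.
Proof. by rewrite -(gf_mulV x) gf_mulA gf_mulgV gf_mul1. Qed.

Lemma gf_inv_unique x y : gf_mul x y = gf_one G a -> x = gf_inv y.
Proof.
by move=> xy; rewrite -[LHS]gf_mulg1 -(gf_mulgV y) gf_mulA xy gf_mul1.
Qed.

End Groups.

Lemma gf_map_one (D : category) (G : grp_functor D) (a b : D) (f : hom b a) :
  ps_map f (gf_one G a) = gf_one G b.
Proof. by apply: gf_idem_one; rewrite -gf_map_mul gf_mul1. Qed.

Lemma gi_one (D : category) (G G' : grp_functor D) (phi : grp_iso G G')
    (a : D) : phi a (gf_one G a) = gf_one G' a.
Proof. by apply: gf_idem_one; rewrite -gi_mul gf_mul1. Qed.

Lemma psmor_bij_iso (D : category) (F G : presheaf D) (f : psmor F G) :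
  (forall a, injective (f a)) -> (forall a y, exists x, f a x = y) ->
  psmor_iso f.
Proof.
move=> f_inj f_surj.
pose g a y := projT1 (cid (f_surj a y)).
have fg a y : f a (g a y) = y := projT2 (cid (f_surj a y)).
have g_nat (a b : D) (h : hom b a) (y : G a) :
    g b (ps_map h y) = ps_map h (g a y).
  by apply: f_inj; rewrite fg pm_nat fg.
exists (@PSMor D G F g g_nat); split; apply: psmor_ext => a x //=.
by apply: f_inj; rewrite fg.
Qed.

Section Twist.

Variable R : realType.
Implicit Types T W S Y : RScheme R.

Definition pull (H : FR R) T W (h : kmor W T) : H T -> H W :=
  @ps_map (Sch R) H T W h.

Lemma pull_comp (H : FR R) T W S (h : kmor W T) (g : kmor S W) (x : H T) :
  pull (kmor_comp h g) x = pull g (pull h x).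
Proof. exact: (@ps_comp (Sch R) H T W S). Qed.

Lemma pull_id (H : FR R) T (x : H T) : pull (kmor_id T) x = x.
Proof. exact: (@ps_id (Sch R) H T). Qed.

Lemma pull_pullE (H : FR R) T W W' S (h : kmor W T) (g : kmor S W)
    (h' : kmor W' T) (g' : kmor S W') (x : H T) :
  kmor_comp h g = kmor_comp h' g' -> pull g (pull h x) = pull g' (pull h' x).
Proof. by rewrite -!pull_comp => ->. Qed.

Lemma pull_nat (H H' : FR R) (phi : psmor H H') T W (h : kmor W T) (x : H T) :
  phi W (pull h x) = pull h (phi T x).
Proof. exact: (@pm_nat (Sch R) H H' phi T W). Qed.

Notation CC := (as_real (SpecC R)).

Definition base_C_mor T W (h : kmor W T) : kmor (base_C W) (base_C T) :=
  kmor_prod h (kmor_id CC).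

Lemma base_C_mor_id T : base_C_mor (kmor_id T) = kmor_id (base_C T).
Proof. by apply: kmor_ext => A p; apply: fp_ext. Qed.

Lemma base_C_mor_comp T W S (h : kmor W T) (g : kmor S W) :
  base_C_mor (kmor_comp h g) = kmor_comp (base_C_mor h) (base_C_mor g).
Proof. by apply: kmor_ext => A p; apply: fp_ext. Qed.

Lemma base_C_mor_sigma T W (h : kmor W T) :
  kmor_comp (base_C_mor h) (sigma W) = kmor_comp (sigma T) (base_C_mor h).
Proof. by apply: kmor_ext => A p; apply: fp_ext. Qed.

Section TwistedForm.

Variable G : grp_functor (Sch R).

Definition is_twisted T (x : G (base_C T)) : Prop :=
  gf_mul (pull (sigma T) x) x = gf_one G (base_C T).

Definition twist_obj T : Type := {x : G (base_C T) | is_twisted x}.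

Lemma twist_ext T (x y : twist_obj T) : sval x = sval y -> x = y.
Proof. by case: x y => [x hx] [y hy] /= e; apply: eq_exist. Qed.

Lemma twist_map_ok T W (h : kmor W T) (x : twist_obj T) :
  is_twisted (pull (base_C_mor h) (sval x)).
Proof.
rewrite /is_twisted (pull_pullE _ (base_C_mor_sigma h)).
rewrite /pull -(@gf_map_mul (Sch R) G) -/(pull _ _) (svalP x).
exact: (@gf_map_one (Sch R)).
Qed.

Definition twist_map T W (h : kmor W T) (x : twist_obj T) : twist_obj W :=
  exist _ _ (twist_map_ok h x).

Lemma twist_map_id T (x : twist_obj T) : twist_map (kmor_id T) x = x.
Proof. by apply: twist_ext; rewrite /= base_C_mor_id pull_id. Qed.

Lemma twist_map_comp T W S (h : kmor W T) (g : kmor S W) (x : twist_obj T) :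
  twist_map (kmor_comp h g) x = twist_map g (twist_map h x).
Proof. by apply: twist_ext; rewrite /= base_C_mor_comp pull_comp. Qed.

Definition twist : FR R := @Presheaf (Sch R) twist_obj twist_map
  twist_map_id twist_map_comp.

End TwistedForm.

Section TwistIso.

Variables (G G' : grp_functor (Sch R)) (phi : grp_iso G G').

Lemma twist_iso_ok T (x : twist G T) : is_twisted (phi (base_C T) (sval x)).
Proof.
rewrite /is_twisted -(pull_nat phi) -(@gi_mul (Sch R)) (svalP x).
exact: (@gi_one (Sch R)).
Qed.

Lemma twist_iso_nat (T W : Sch R) (h : hom W T) (x : twist G T) :
  exist _ _ (twist_iso_ok (ps_map h x)) =
  ps_map h (exist _ _ (twist_iso_ok x) : twist G' T).
Proof. by apply: twist_ext; rewrite /= (pull_nat phi). Qed.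

Definition twist_iso : psmor (twist G) (twist G') :=
  @PSMor (Sch R) (twist G) (twist G')
    (fun T x => exist _ _ (twist_iso_ok x)) twist_iso_nat.

End TwistIso.

Lemma twist_iso_id (G : grp_functor (Sch R)) :
  twist_iso (grp_iso_id G) = psmor_id (twist G).
Proof. by apply: psmor_ext => T x; apply: twist_ext. Qed.

Lemma twist_iso_comp (G G' G'' : grp_functor (Sch R)) (g : grp_iso G' G'')
    (f : grp_iso G G') :
  twist_iso (grp_iso_comp g f) = psmor_comp (twist_iso g) (twist_iso f).
Proof. by apply: psmor_ext => T x; apply: twist_ext. Qed.

Definition twist_construction : grp_construction (Sch R) :=
  GrpConstruction twist_iso_id twist_iso_comp.

(** * The two components over a complex scheme, and gluing of morphisms along them *)

Definition str_C (T : CScheme R) : kmor (as_real T) CC :=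
  restr_mor (R_to_C R) (to_point T).

(** The component of [T_C] on which its two complex structures coincide. *)
Definition diag (T : CScheme R) : kmor (as_real T) (base_C (as_real T)) :=
  pairing (kmor_id (as_real T)) (str_C T).

Lemma diag_nat (T W : CScheme R) (h : kmor W T) :
  kmor_comp (diag T) (restr_mor (R_to_C R) h) =
  kmor_comp (base_C_mor (restr_mor (R_to_C R) h)) (diag W).
Proof.
apply: kmor_ext => A w; apply: fp_ext => //=.
exact: (km_str h).
Qed.

Lemma twist_triv_nat (G : grp_functor (Sch R)) (T W : Sch R[i]) (h : hom W T)
    (z : complexify (twist G) T) :
  pull (diag W) (sval (ps_map h z)) =
  ps_map h (pull (diag T) (sval z) : complexify G T).
Proof. exact/esym/pull_pullE/diag_nat. Qed.

Definition twist_triv (G : grp_functor (Sch R)) :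
    psmor (complexify (twist G)) (complexify G) :=
  @PSMor (Sch R[i]) (complexify (twist G)) (complexify G)
    (fun V z => pull (diag V) (sval z)) (twist_triv_nat (G := G)).

(** The loci of [W] where [c] equals [d] and where it is conjugate to [d] are complementary, open
    and closed. Points are glued over each algebra, and their uniqueness makes the choice
    natural. *)
Lemma kmor_glue W Y (c d : kmor W CC) (f g : kmor W Y) :
  exists k : kmor W Y, forall A (w : W A),
    (c A w = d A w -> k A w = f A w) /\
    (c A w = kmor_comp (tau R) d A w -> k A w = g A w).
Proof.
have cd A (w : W A) : same_real (c A w : {rmorphism R[i] -> A}) (d A w).
  move=> a; have := etrans (km_str c w) (esym (km_str d w)).
  exact: (congr1 (fun h : {rmorphism R -> A} => h a)).
pose k A w := projT1 (cid (glue_exists (f A w) (g A w) (cd A w))).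
have kP A w : glues (c A w) (d A w) (f A w) (g A w) (k A w).
  exact: projT2 (cid (glue_exists (f A w) (g A w) (cd A w))).
have k_nat (A B : comPzRingType) (h : {rmorphism A -> B}) (w : W A) :
    k B (rf_map h w) = rf_map h (k A w).
  apply: (glues_unique (cd B _) (kP B _)) => C h'.
  have [H1 H2] := kP A w C (h' \o h).
  rewrite !rm_nat -!rf_comp; split=> e; [apply: H1|apply: H2];
    apply: rmorph_ext => a;
    exact: (congr1 (fun m : {rmorphism R[i] -> C} => m a) e).
have k_str (A : comPzRingType) (w : W A) :
    ks_str Y A (k A w) = ks_str W A w.
  (* Compatibility with the structure maps is an equality of points of the spectrum of [R], checked
     on the two loci. *)
  apply: (@conj_split_separated R (affine_scheme R) _ _ _ _ _ (cd A w)) => B h.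
  have [H1 H2] := kP A w B h.
  case=> e; transitivity (ks_str Y B (rf_map h (k A w)));
    [exact/esym/rm_nat | | exact/esym/rm_nat |].
    by rewrite (H1 e) rm_nat km_str.
  by rewrite (H2 e) rm_nat km_str.
exists (@KMor R W Y (RMor k_nat) k_str) => A w /=.
have [H1 H2] := kP A w A idfun; rewrite !rf_id in H1 H2.
split=> e; [apply: H1|apply: H2]; apply: rmorph_ext => a;
  exact: (congr1 (fun m : {rmorphism R[i] -> A} => m a) e).
Qed.

Lemma kmor_split_ext W Y (c d : kmor W CC) (f g : kmor W Y) :
  (forall A (w : W A), c A w = d A w \/ c A w = kmor_comp (tau R) d A w ->
    f A w = g A w) ->
  f = g.
Proof.
move=> H; apply: kmor_ext => A w.
apply: (@conj_split_separated R Y A (c A w) (d A w)) => [a|B h e].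
  have := etrans (km_str c w) (esym (km_str d w)).
  exact: (congr1 (fun h : {rmorphism R -> A} => h a)).
rewrite -!rm_nat; apply: H; rewrite !rm_nat.
case: e => e; [left|right]; apply: rmorph_ext => a;
  exact: (congr1 (fun m : {rmorphism R[i] -> B} => m a) e).
Qed.

End Twist.

(** * Automorphisms of [X] over a base *)

Section AutTwist.

Variables (R : realType) (X : RScheme R).
Implicit Types T W : RScheme R.

Notation CC := (as_real (SpecC R)).

(** An automorphism over [T] preserves the component in [T], so this component in [X] determines
    it. *)
Definition fibre T (f : Aut X T) : kmor (fp T X) X :=
  kmor_comp (pr2 T X) (sval f).

Lemma fibre_ext T (f g : Aut X T) : fibre f = fibre g -> f = g.
Proof.
move=> fg; apply: aut_ext => A p; apply: fp_ext.
  by rewrite (is_aut_over_pr1 (svalP f)) (is_aut_over_pr1 (svalP g)).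
exact: (congr1 (fun h : kmor (fp T X) X => h A p) fg).
Qed.

Lemma aut_point T (f : Aut X T) : sval f = pairing (pr1 T X) (fibre f).
Proof.
apply: kmor_ext => A p; apply: fp_ext => //=.
exact: (is_aut_over_pr1 (svalP f)).
Qed.

Lemma fibre_one T : fibre (gf_one (Aut X) T) = pr2 T X.
Proof. exact: kmor_ext. Qed.

Lemma fibre_mul T (f g : Aut X T) :
  fibre (gf_mul f g) = kmor_comp (fibre f) (pairing (pr1 T X) (fibre g)).
Proof. by rewrite -aut_point; apply: kmor_ext. Qed.

Lemma fibre_pull T W (h : kmor W T) (f : Aut X T) :
  fibre (pull h f) = kmor_comp (fibre f) (kmor_prod h (kmor_id X)).
Proof. exact: kmor_ext. Qed.

Lemma aut_of_fibres T (f g : kmor (fp T X) X) :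
  kmor_comp f (pairing (pr1 T X) g) = pr2 T X ->
  kmor_comp g (pairing (pr1 T X) f) = pr2 T X ->
  exists k : Aut X T, fibre k = f.
Proof.
move=> fg gf.
have ok : is_aut_over (pairing (pr1 T X) f).
  split; first exact: kmor_ext.
  exists (pairing (pr1 T X) g); split; apply: kmor_ext => A p;
    apply: fp_ext => //=.
    exact: (congr1 (fun h : kmor (fp T X) X => h A p) gf).
  exact: (congr1 (fun h : kmor (fp T X) X => h A p) fg).
by exists (exist _ _ ok); apply: kmor_ext.
Qed.

Lemma kmorE (Y W : RScheme R) (f g : kmor Y W) :
  f = g -> forall A (y : Y A), f A y = g A y.
Proof. by move=> ->. Qed.

Lemma fibre_mulV T (f g : Aut X T) : gf_mul f g = gf_one (Aut X) T ->
  kmor_comp (fibre f) (pairing (pr1 T X) (fibre g)) = pr2 T X.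
Proof. by rewrite -fibre_mul => ->; apply: fibre_one. Qed.

(** The components in [X] of [f] and [g] are glued, and so are those of their inverses; the results
    are mutually inverse because they are so on each locus. *)
Lemma aut_glue T (c d : kmor T CC) (f g : Aut X T) :
  exists k : Aut X T, forall A (p : fp T X A),
    (c A (sval p).1 = d A (sval p).1 -> fibre k A p = fibre f A p) /\
    (c A (sval p).1 = kmor_comp (tau R) d A (sval p).1 ->
      fibre k A p = fibre g A p).
Proof.
pose f' := gf_inv f; pose g' := gf_inv g.
pose c1 := kmor_comp c (pr1 T X); pose d1 := kmor_comp d (pr1 T X).
have [k kP] := kmor_glue c1 d1 (fibre f) (fibre g).
have [k' kP'] := kmor_glue c1 d1 (fibre f') (fibre g').
have [||h hk] := @aut_of_fibres T k k'; last by exists h; rewrite hk.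
- apply: (kmor_split_ext (c := c1) (d := d1)) => A p /=.
  set q := pairing_fun _ _ _; have [k1 k2] := kP A q; have [k1' k2'] := kP' A p.
  case=> e.
    rewrite (k1 e); rewrite -[RHS](kmorE (fibre_mulV (gf_mulgV f))) /=.
    by congr (sval (_ A _)).2; apply: fp_ext => //=; rewrite (k1' e).
  rewrite (k2 e); rewrite -[RHS](kmorE (fibre_mulV (gf_mulgV g))) /=.
  by congr (sval (_ A _)).2; apply: fp_ext => //=; rewrite (k2' e).
- apply: (kmor_split_ext (c := c1) (d := d1)) => A p /=.
  set q := pairing_fun _ _ _; have [k1 k2] := kP A p; have [k1' k2'] := kP' A q.
  case=> e.
    rewrite (k1' e); rewrite -[RHS](kmorE (fibre_mulV (gf_mulV f))) /=.
    by congr (sval (_ A _)).2; apply: fp_ext => //=; rewrite (k1 e).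
  rewrite (k2' e); rewrite -[RHS](kmorE (fibre_mulV (gf_mulV g))) /=.
  by congr (sval (_ A _)).2; apply: fp_ext => //=; rewrite (k2 e).
Qed.

Lemma aut_split_ext T (c d : kmor T CC) (f g : Aut X T) :
  (forall A (p : fp T X A), c A (sval p).1 = d A (sval p).1 \/
    c A (sval p).1 = kmor_comp (tau R) d A (sval p).1 ->
    fibre f A p = fibre g A p) ->
  f = g.
Proof.
move=> H; apply: fibre_ext.
apply: (kmor_split_ext (c := kmor_comp c (pr1 T X))
  (d := kmor_comp d (pr1 T X))).
exact: H.
Qed.

(** The two complex structures of [V_C]: [cs] comes from [V], and [ct] from the second factor. *)
Notation cs V := (kmor_comp (str_C V) (pr1 (as_real V) CC)).
Notation ct V := (pr2 (as_real V) CC).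

Lemma tauK : kmor_comp (tau R) (tau R) = kmor_id CC.
Proof.
by apply: kmor_ext => A c; apply: rmorph_ext => z /=; rewrite conjcK.
Qed.

Lemma tau_swap A (c d : CC A) : c = tau R A d <-> d = tau R A c.
Proof.
have K (a : CC A) : tau R A (tau R A a) = a := kmorE tauK a.
by split=> ->; rewrite K.
Qed.

Lemma diag_cover (V : CScheme R) A (p : base_C (as_real V) A) :
  cs V A p = ct V A p -> p = diag V A (sval p).1.
Proof. by move=> e; apply: fp_ext => //=; rewrite -e. Qed.

Lemma antidiag_cover (V : CScheme R) A (p : base_C (as_real V) A) :
  cs V A p = kmor_comp (tau R) (ct V) A p ->
  p = sigma (as_real V) A (diag V A (sval p).1).
Proof. by move=> e; apply: fp_ext => //=; apply/tau_swap. Qed.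

(** The component of [V_C] on which its two complex structures are conjugate. *)
Definition antidiag (V : CScheme R) : kmor (as_real V) (base_C (as_real V)) :=
  kmor_comp (sigma (as_real V)) (diag V).

Lemma kmor_diag_ext (V : CScheme R) (Y : RScheme R)
    (f g : kmor (base_C (as_real V)) Y) :
  kmor_comp f (diag V) = kmor_comp g (diag V) ->
  kmor_comp f (antidiag V) = kmor_comp g (antidiag V) -> f = g.
Proof.
move=> e1 e2; apply: (kmor_split_ext (c := cs V) (d := ct V)) => A p.
case=> [/diag_cover|/antidiag_cover] ->; first exact: (kmorE e1).
exact: (kmorE e2).
Qed.

Lemma kmor_diag_glue (V : CScheme R) (Y : RScheme R)
    (f g : kmor (as_real V) Y) :
  exists k : kmor (base_C (as_real V)) Y,
    kmor_comp k (diag V) = f /\ kmor_comp k (antidiag V) = g.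
Proof.
have [k kP] := kmor_glue (cs V) (ct V) (kmor_comp f (pr1 (as_real V) CC))
  (kmor_comp g (pr1 (as_real V) CC)).
exists k; split; apply: kmor_ext => A v /=.
  by have [-> //] := kP A (diag V A v).
by have [_ ->//] := kP A (antidiag V A v); apply/tau_swap.
Qed.

Lemma aut_diag_ext (V : CScheme R) (f g : Aut X (base_C (as_real V))) :
  pull (diag V) f = pull (diag V) g ->
  pull (antidiag V) f = pull (antidiag V) g -> f = g.
Proof.
move=> e1 e2; apply: (aut_split_ext (c := cs V) (d := ct V)) => A p H.
have p_ok : ks_str (as_real V) A (sval (sval p).1).1 = ks_str X A (sval p).2.
  exact: (svalP p).
(* A point over either component is the image of the point [q] with the same coordinates in [V] and
   in [X]. *)
have [q lift] : exists q : fp (as_real V) X A,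
    forall h : kmor (as_real V) (base_C (as_real V)),
    (sval p).1 = h A (sval (sval p).1).1 -> p = kmor_prod h (kmor_id X) A q.
  by exists (exist _ (_, _) p_ok) => h e; apply: fp_ext.
case: H => [/diag_cover e|/antidiag_cover e].
  rewrite (lift _ e); have := kmorE (congr1 (@fibre _) e1) q.
  by rewrite !fibre_pull.
rewrite (lift (antidiag V) e); have := kmorE (congr1 (@fibre _) e2) q.
by rewrite !fibre_pull.
Qed.

Lemma aut_diag_glue (V : CScheme R) (f g : Aut X (as_real V)) :
  exists k : Aut X (base_C (as_real V)),
    pull (diag V) k = f /\ pull (antidiag V) k = g.
Proof.
have [k kP] := aut_glue (cs V) (ct V) (pull (pr1 (as_real V) CC) f)
  (pull (pr1 (as_real V) CC) g).
exists k; split; apply: fibre_ext; apply: kmor_ext => A q; rewrite fibre_pull.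
  have [e _] := kP A (kmor_prod (diag V) (kmor_id X) A q).
  by apply: (etrans (e erefl)); congr (sval (sval f A _)).2; apply: fp_ext.
have [_ e] := kP A (kmor_prod (antidiag V) (kmor_id X) A q).
apply: (etrans (e _)); first by apply/tau_swap.
by congr (sval (sval g A _)).2; apply: fp_ext.
Qed.

Lemma pull_mul (G : grp_functor (Sch R)) T W (h : kmor W T) (x y : G T) :
  pull h (gf_mul x y) = gf_mul (pull h x) (pull h y).
Proof. exact: (@gf_map_mul (Sch R) G T W). Qed.

Lemma pull_one (G : grp_functor (Sch R)) T W (h : kmor W T) :
  pull h (gf_one G T) = gf_one G W.
Proof. exact: (@gf_map_one (Sch R) G T W). Qed.

(** This is the pullback of the cocycle equation along [diag]. *)
Lemma twist_antidiag (G : grp_functor (Sch R)) (V : CScheme R)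
    (z : twist G (as_real V)) :
  pull (antidiag V) (sval z) = gf_inv (pull (diag V) (sval z)).
Proof.
apply: gf_inv_unique.
by rewrite /antidiag pull_comp -pull_mul (svalP z) pull_one.
Qed.

Lemma twist_triv_iso : psmor_iso (twist_triv (Aut X)).
Proof.
apply: psmor_bij_iso => V.
  move=> z w zw; apply/twist_ext/aut_diag_ext => //.
  by rewrite !twist_antidiag; congr gf_inv.
(* The cocycle equation forces the inverse of [f] as the value on the second component. *)
move=> f; have [k [k1 k2]] := aut_diag_glue f (gf_inv (f : Aut X (as_real V))).
(* The involution exchanges the two components, so the cocycle equation becomes the left inverse law
   on one and the right inverse law on the other. *)
have antidiagK : kmor_comp (sigma (as_real V)) (antidiag V) = diag V.
  by rewrite /antidiag kmor_comp_assoc sigmaK kmor_comp_idl.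
suff k_ok : is_twisted k by exists (exist _ k k_ok).
apply: aut_diag_ext; rewrite pull_mul -pull_comp pull_one.
  rewrite -[kmor_comp _ (diag V)]/(antidiag V) k1 k2; exact: gf_mulV.
rewrite antidiagK k1 k2; exact: gf_mulgV.
Qed.

End AutTwist.

(** * Real points of the twisted form *)

Section Cocycles.

Variables (R : realType) (X : RScheme R).

Notation CC := (as_real (SpecC R)).

Definition unswap : kmor (fp CC X) (base_C X) := pairing (pr2 CC X) (pr1 CC X).

Lemma rmorE (Y Z : rfunctor) (f g : rmor Y Z) :
  f = g -> forall A (y : Y A), f A y = g A y.
Proof. by move=> ->. Qed.

Lemma conj_aut_str (w : Aut X CC) A (p : scheme_C X A) :
  ks_str (scheme_C X) A (unswap A (sval w A (swap X A p))) =
  ks_str (scheme_C X) A p.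
Proof. by rewrite /= (is_aut_over_pr1 (svalP w)). Qed.

(** Exchanging the two factors turns automorphisms of the product over the spectrum of the complex
    numbers into automorphisms of the complex scheme [X_C]. *)
Definition aut_C (w : Aut X CC) : kmor (scheme_C X) (scheme_C X) :=
  @KMor R[i] (scheme_C X) (scheme_C X)
    (rmor_comp unswap (rmor_comp (sval w) (swap X))) (conj_aut_str w).

Lemma swap_aut_C (w : Aut X CC) :
  rmor_comp (swap X) (aut_C w) = rmor_comp (sval w) (swap X).
Proof. by apply: rmor_ext => A p; apply: fp_ext. Qed.

Lemma aut_C_one : aut_C (gf_one (Aut X) CC) = kmor_id (scheme_C X).
Proof. by apply: kmor_ext => A p; apply: fp_ext. Qed.

Lemma aut_C_mul (v w : Aut X CC) :
  aut_C (gf_mul v w) = kmor_comp (aut_C v) (aut_C w).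
Proof.
apply: kmor_ext => A p; congr (unswap A (sval v A _)).
by apply: fp_ext.
Qed.

(** This is the Galois action of complex conjugation, [sigma X] being its own inverse. *)
Lemma aut_C_tau (w : Aut X CC) : km_fun (aut_C (pull (tau R) w)) =
  rmor_comp (sigma X) (rmor_comp (aut_C w) (sigma X)).
Proof.
apply: rmor_ext => A p; apply: fp_ext => /=.
  by congr (sval (sval w A _)).2; apply: fp_ext.
rewrite (is_aut_over_pr1 (svalP w)) /=.
by apply: rmorph_ext => z /=; rewrite conjcK.
Qed.

Lemma aut_C_inj : injective aut_C.
Proof.
move=> v w vw; apply: fibre_ext; apply: kmor_ext => A p.
have := congr1 (fun h : kmor (scheme_C X) (scheme_C X) =>
  (sval (h A (unswap A p))).1) vw.
rewrite /=; set q := pairing_fun _ _ _.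
by have -> : q = p by apply: fp_ext.
Qed.

Lemma aut_C_surj (Psi : kmor (scheme_C X) (scheme_C X)) :
  @is_iso (Sch R[i]) (scheme_C X) (scheme_C X) Psi ->
  exists w, aut_C w = Psi.
Proof.
case=> Phi [PhiPsi PsiPhi].
have str (F : kmor (scheme_C X) (scheme_C X)) A (p : fp CC X A) :
    ks_str X A (sval (F A (unswap A p))).1 = ks_str (fp CC X) A p.
  rewrite (svalP (F A (unswap A p))).
  exact: (congr1 (ks_str CC A) (km_str F (unswap A p))).
(* The components in [X] of [Psi] and of its inverse are the data that [aut_of_fibres] asks for. *)
pose fib (F : kmor (scheme_C X) (scheme_C X)) := @KMor R (fp CC X) X
  (rmor_comp (pr1 X CC) (rmor_comp (km_fun F) unswap)) (str F).
have fib_comp F F' : kmor_comp F F' = kmor_id (scheme_C X) ->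
    kmor_comp (fib F) (pairing (pr1 CC X) (fib F')) = pr2 CC X.
  move=> FF'; apply: kmor_ext => A p /=.
  set q := pairing_fun _ _ _.
  have -> : q = F' A (unswap A p).
    by apply: fp_ext => //=; exact: (esym (km_str F' (unswap A p))).
  have := congr1 (fun h : kmor (scheme_C X) (scheme_C X) =>
    (sval (h A (unswap A p))).1) FF'.
  by [].
have [w wE] := aut_of_fibres (fib_comp _ _ PsiPhi) (fib_comp _ _ PhiPsi).
exists w; apply: kmor_ext => A p; apply: fp_ext.
  have us : unswap A (swap X A p) = p by apply: fp_ext.
  apply: (etrans (kmorE wE (swap X A p))).
  exact: (congr1 (fun q : scheme_C X A => (sval (Psi A q)).1) us).
rewrite /= (is_aut_over_pr1 (svalP w)) /=.
exact: (esym (km_str Psi p)).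
Qed.

(** The isomorphism [Spec C -> Spec R x Spec C]. *)
Definition point_C : kmor CC (base_C (SpecR R)) :=
  kmor_comp (base_C_mor (to_point CC)) (diag (SpecC R)).

Lemma pr2_point_C : kmor_comp (pr2 (SpecR R) CC) point_C = kmor_id CC.
Proof. by apply: kmor_ext => A c; apply: rmorph_ext. Qed.

Lemma point_C_pr2 :
  kmor_comp point_C (pr2 (SpecR R) CC) = kmor_id (base_C (SpecR R)).
Proof.
apply: kmor_ext => A p; apply: fp_ext => /=; last exact: rmorph_ext.
exact: (esym (svalP p)).
Qed.

(** Through [point_C] the involution becomes complex conjugation, which turns the equation of
    [twist] into the cocycle equation. *)
Lemma point_C_tau :
  kmor_comp (sigma (SpecR R)) point_C = kmor_comp point_C (tau R).
Proof.
apply: kmor_ext => A c; apply: fp_ext => /=; last exact: rmorph_ext.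
by apply: rmorph_ext => a /=; rewrite oppr0.
Qed.

(** The map [aut_C] is injective, and it turns products into composites and pullback along [tau]
    into conjugation by [sigma X]. *)
Lemma cocycleP (w : Aut X CC) :
  is_cocycle (aut_C w) <-> gf_mul (pull (tau R) w) w = gf_one (Aut X) CC.
Proof.
have E : km_fun (aut_C (gf_mul (pull (tau R) w) w)) =
    rmor_comp (sigma X) (rmor_comp (aut_C w) (rmor_comp (sigma X) (aut_C w))).
  rewrite aut_C_mul; apply: rmor_ext => A p.
  exact: (rmorE (aut_C_tau w) (aut_C w A p)).
split=> [[_]|ww]; last first.
  split; last by rewrite -E ww aut_C_one.
  exists (aut_C (gf_inv w)); split; rewrite [LHS]/= -aut_C_mul.
    by rewrite gf_mulV aut_C_one.
  by rewrite gf_mulgV aut_C_one.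
rewrite -E => e; apply: aut_C_inj; rewrite aut_C_one.
by apply: kmor_ext => A p; rewrite (rmorE e).
Qed.

Lemma real_point_cocycle (z : twist (Aut X) (SpecR R)) :
  is_cocycle (aut_C (pull point_C (sval z))).
Proof.
apply/cocycleP; rewrite -(pull_comp point_C) -point_C_tau pull_comp.
by rewrite -pull_mul (svalP z) pull_one.
Qed.

Definition cocycle_of (z : twist (Aut X) (SpecR R)) : cocycles X :=
  exist _ _ (real_point_cocycle z).

Lemma cocycle_of_bij : bijective cocycle_of.
Proof.
have inj : injective cocycle_of.
  move=> z w zw; apply: twist_ext.
  have e : pull point_C (sval z) = pull point_C (sval w).
    exact: (aut_C_inj (congr1 sval zw)).
  rewrite -[LHS]pull_id -[RHS]pull_id -point_C_pr2.
  by rewrite !(pull_comp point_C) e.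
have surj Psi : exists z, cocycle_of z = Psi.
  case: Psi => Psi cPsi; have [w wE] := aut_C_surj (proj1 cPsi); subst Psi.
  (* The preimage is [w] transported along the inverse of [point_C]. *)
  have z_ok : is_twisted (pull (pr2 (SpecR R) CC) w).
    rewrite /is_twisted -pull_comp.
    have -> : kmor_comp (pr2 (SpecR R) CC) (sigma (SpecR R)) =
      kmor_comp (tau R) (pr2 (SpecR R) CC) by apply: kmor_ext.
    by rewrite pull_comp -pull_mul (proj1 (cocycleP w) cPsi) pull_one.
  exists (exist _ _ z_ok); apply: eq_exist.
  have e : pull point_C (pull (pr2 (SpecR R) CC) w) = w.
    by rewrite -pull_comp pr2_point_C pull_id.
  exact: (congr1 aut_C e).
exists (fun Psi => projT1 (cid (surj Psi))) => [z|Psi]; last first.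
  exact: (projT2 (cid (surj Psi))).
by apply: inj; exact: (projT2 (cid (surj (cocycle_of z)))).
Qed.

Lemma cocycle_ofE (z : twist (Aut X) (SpecR R)) :
  rmor_comp (swap X) (sval (cocycle_of z)) =
  rmor_comp (sval (twist_triv (Aut X) (SpecC R) (pull (to_point CC) z)))
    (swap X).
Proof.
have e : pull point_C (sval z) =
  twist_triv (Aut X) (SpecC R) (pull (to_point CC) z) :> Aut X CC.
  exact: pull_comp.
apply: (etrans (swap_aut_C _)).
exact: (congr1 (fun w : Aut X CC => rmor_comp (sval w) (swap X)) e).
Qed.

End Cocycles.

(** * The universal relative form *)

Section Universal.

Variables (R : realType) (X : RScheme R).
Implicit Types T W : RScheme R.

Notation CC := (as_real (SpecC R)).
Notation Z := (twist (Aut X)).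

(** The action of automorphisms over [T] on the sections of the product with [X], that is, on the
    [T]-points of [X]. *)
Definition act T (f : Aut X T) (x : kmor T X) : kmor T X :=
  kmor_comp (fibre f) (pairing (kmor_id T) x).

Lemma act_one T (x : kmor T X) : act (gf_one (Aut X) T) x = x.
Proof. exact: kmor_ext. Qed.

Lemma act_mul T (f g : Aut X T) (x : kmor T X) :
  act (gf_mul f g) x = act f (act g x).
Proof.
rewrite /act fibre_mul; apply: kmor_ext => A t /=.
by congr (sval (sval f A _)).2; apply: fp_ext.
Qed.

Lemma act_pull T W (h : kmor W T) (f : Aut X T) (x : kmor T X) :
  act (pull h f) (kmor_comp x h) = kmor_comp (act f x) h.
Proof.
rewrite /act fibre_pull; apply: kmor_ext => A t /=.
by congr (sval (sval f A _)).2; apply: fp_ext.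
Qed.

Definition univ_obj T : Type := {p : Z T * kmor (base_C T) X |
  act (sval p.1) p.2 = kmor_comp p.2 (sigma T)}.

Lemma univ_ext T (p q : univ_obj T) :
  (sval p).1 = (sval q).1 -> (sval p).2 = (sval q).2 -> p = q.
Proof.
by case: p q => [[z x] hp] [[w y] hq] /= e e'; apply: eq_exist; congr pair.
Qed.

Lemma univ_map_ok T W (h : kmor W T) (p : univ_obj T) :
  act (sval (pull h (sval p).1)) (kmor_comp (sval p).2 (base_C_mor h)) =
  kmor_comp (kmor_comp (sval p).2 (base_C_mor h)) (sigma W).
Proof.
rewrite [LHS]act_pull (svalP p) -!kmor_comp_assoc.
by rewrite base_C_mor_sigma.
Qed.

Definition univ_map T W (h : kmor W T) (p : univ_obj T) : univ_obj W :=
  exist _ (_, _) (univ_map_ok h p).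

Lemma univ_map_id T (p : univ_obj T) : univ_map (kmor_id T) p = p.
Proof.
apply: univ_ext => /=; first exact: (pull_id (H := Z)).
by rewrite base_C_mor_id kmor_comp_idr.
Qed.

Lemma univ_map_comp T W S (h : kmor W T) (g : kmor S W) (p : univ_obj T) :
  univ_map (kmor_comp h g) p = univ_map g (univ_map h p).
Proof.
apply: univ_ext => /=; first exact: (pull_comp (H := Z)).
by rewrite base_C_mor_comp kmor_comp_assoc.
Qed.

Definition univ : FR R :=
  @Presheaf (Sch R) univ_obj univ_map univ_map_id univ_map_comp.

Definition univ_proj : psmor univ Z :=
  @PSMor (Sch R) univ Z (fun _ p => (sval p).1) (fun _ _ _ _ => erefl).

Lemma univ_triv_nat (V W : Sch R[i]) (h : hom W V) (p : complexify univ V) :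
  ((sval (ps_map h p)).1, kmor_comp (sval (ps_map h p)).2 (diag W)) =
  ps_map h (((sval p).1, kmor_comp (sval p).2 (diag V))
    : complexify (prod_with Z X) V).
Proof.
congr pair; rewrite [LHS]/= [RHS]/= -kmor_comp_assoc -diag_nat.
exact: kmor_comp_assoc.
Qed.

Definition univ_triv : psmor (complexify univ) (complexify (prod_with Z X)) :=
  @PSMor (Sch R[i]) (complexify univ) (complexify (prod_with Z X))
    (fun V p => ((sval p).1, kmor_comp (sval p).2 (diag V))) univ_triv_nat.

(** The equation defining [univ_obj] determines the second component from the first. *)
Lemma univ_antidiag (V : CScheme R) (p : univ (as_real V)) :
  kmor_comp (sval p).2 (antidiag V) =
  act (pull (diag V) (sval (sval p).1)) (kmor_comp (sval p).2 (diag V)).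
Proof. by rewrite act_pull (svalP p) /antidiag kmor_comp_assoc. Qed.

Lemma univ_triv_iso : psmor_iso univ_triv.
Proof.
apply: psmor_bij_iso => V.
  move=> p q pq; have pq2 := congr1 snd pq.
  have pq1 : (sval p).1 = (sval q).1 := congr1 fst pq.
  apply: univ_ext => //.
  apply: kmor_diag_ext => //.
  apply: (etrans (univ_antidiag p)); apply: etrans (esym (univ_antidiag q)).
  by rewrite pq1; congr act.
case=> z y.
have [x [x1 x2]] := kmor_diag_glue y (act (pull (diag V) (sval z)) y).
suff x_ok : act (sval z) x = kmor_comp x (sigma (as_real V)).
  by exists (exist _ (z, x) x_ok); congr pair.
apply: kmor_diag_ext.
  rewrite -act_pull x1 -kmor_comp_assoc.
  by rewrite -[kmor_comp (sigma _) _]/(antidiag V) x2.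
(* On the second component [z] restricts to the inverse of its first restriction, so it carries the
   value there back to [y]. *)
rewrite -act_pull x2 twist_antidiag -act_mul gf_mulV act_one -kmor_comp_assoc.
by rewrite /antidiag (kmor_comp_assoc (sigma _)) sigmaK kmor_comp_idl x1.
Qed.

Lemma univ_over : complexify_mor univ_proj =
  psmor_comp (complexify_mor (ps_pr1 Z (point_functor X))) univ_triv.
Proof. exact: psmor_ext. Qed.

Definition universal_form : relative_form X Z :=
  RelativeForm univ_triv_iso univ_over.

End Universal.

(** * Completeness of the universal form *)

Section Completeness.

Variables (R : realType) (X S : RScheme R).
Variable F : relative_form X (point_functor S).
Implicit Types T W : RScheme R.

Notation CC := (as_real (SpecC R)).

(** The scheme [W] made complex through [c]. Restricted to the reals it is [W] with its structure
    map factored through [c]; [of_with_C] and [to_with_C] are the identity between the two. *)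
Definition with_C W (c : kmor W CC) : CScheme R := @KScheme R[i] W (km_fun c).

Lemma real_with_C_str W (c : kmor W CC) A (w : W A) :
  ks_str W A w = ks_str (as_real (with_C c)) A w.
Proof. exact/esym/(km_str c). Qed.

Definition of_with_C W (c : kmor W CC) : kmor (as_real (with_C c)) W :=
  @KMor R (as_real (with_C c)) W (rmor_id W) (real_with_C_str c).

Definition to_with_C W (c : kmor W CC) : kmor W (as_real (with_C c)) :=
  @KMor R W (as_real (with_C c)) (rmor_id W)
    (fun A w => esym (real_with_C_str c w)).

(** The trivialization of [F] over the complex scheme [(W, c)], transported
    to [W]. *)
Definition triv_over W (c : kmor W CC) (a : F W) : kmor W X :=
  kmor_comp (rel_triv F (with_C c) (pull (of_with_C c) a)).2 (to_with_C c).

(** The condition makes [f] a morphism of complex schemes from [(W, c)] to [V], and the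
    trivialization is natural. *)
Lemma triv_over_gen (V : CScheme R) W (c : kmor W CC)
    (f : kmor W (as_real V)) (a : F (as_real V)) :
  kmor_comp (str_C V) f = c ->
  triv_over c (pull f a) = kmor_comp (rel_triv F V a).2 f.
Proof.
move=> <-; set c' := kmor_comp _ f.
pose g : kmor (with_C c') V :=
  @KMor R[i] (with_C c') V (km_fun f) (fun _ _ => erefl).
have e : pull (of_with_C c') (pull f a) = pull (restr_mor (R_to_C R) g) a.
  by rewrite -pull_comp; congr pull; apply: kmor_ext.
have nat : rel_triv F (with_C c') (pull (restr_mor (R_to_C R) g) a) =
    @ps_map (Sch R[i]) (complexify (prod_with (point_functor S) X)) V
      (with_C c') g (rel_triv F V a).
  exact: (@pm_nat (Sch R[i]) _ _ (rel_triv F) V (with_C c') g a).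
by rewrite /triv_over e nat; apply: kmor_ext.
Qed.

Lemma triv_over_nat W W' (c : kmor W CC) (f : kmor W' W) (a : F W) :
  triv_over (kmor_comp c f) (pull f a) = kmor_comp (triv_over c a) f.
Proof.
transitivity (kmor_comp (rel_triv F (with_C c) (pull (of_with_C c) a)).2
  (kmor_comp (to_with_C c) f)); last exact: kmor_ext.
rewrite -(triv_over_gen (c := kmor_comp c f)); last exact: kmor_ext.
by congr triv_over; rewrite -pull_comp; congr pull; apply: kmor_ext.
Qed.

Lemma triv_over_real (V : CScheme R) (a : F (as_real V)) :
  triv_over (str_C V) a = (rel_triv F V a).2.
Proof.
rewrite -[a in LHS]pull_id (@triv_over_gen V); first exact: kmor_comp_idr.
exact: kmor_comp_idr.
Qed.

Lemma rel_projE (V : CScheme R) (a : F (as_real V)) :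
  rel_proj F (as_real V) a = (rel_triv F V a).1.
Proof. exact: (@psmor_eq (Sch R[i]) _ _ _ _ (rel_over F) V). Qed.

Lemma rel_proj_pull W W' (f : kmor W' W) (a : F W) :
  rel_proj F W' (pull f a) = kmor_comp (rel_proj F W a) f.
Proof. exact: (@pm_nat (Sch R) _ _ (rel_proj F) W W' f a). Qed.

Lemma with_CK W (c : kmor W CC) (a : F W) :
  pull (to_with_C c) (pull (of_with_C c) a) = a.
Proof.
by rewrite -pull_comp -[RHS]pull_id; congr pull; apply: kmor_ext.
Qed.

(** Since [F] is trivial over [(W, c)], its elements over [W] correspond to pairs of a [W]-point of
    [S] and one of [X]; [triv_over_surj] is the other half. *)
Lemma triv_over_inj W (c : kmor W CC) (a b : F W) :
  rel_proj F W a = rel_proj F W b -> triv_over c a = triv_over c b -> a = b.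
Proof.
move=> pab tab; rewrite -(with_CK c a) -(with_CK c b); congr pull.
have [g [gt _]] := rel_triv_iso F.
have inj : injective (rel_triv F (with_C c)).
  apply: (can_inj (g := g (with_C c))) => x.
  exact: (@psmor_eq (Sch R[i]) _ _ _ _ gt (with_C c)).
apply: inj; rewrite [LHS]surjective_pairing [RHS]surjective_pairing; congr pair.
  by rewrite -!rel_projE !rel_proj_pull pab.
apply: kmor_ext => A w; exact: (kmorE tab).
Qed.

Lemma triv_over_surj W (c : kmor W CC) (p : kmor W S) (x : kmor W X) :
  exists a : F W, rel_proj F W a = p /\ triv_over c a = x.
Proof.
have [g [_ tg]] := rel_triv_iso F.
pose q : complexify (prod_with (point_functor S) X) (with_C c) :=
  (kmor_comp p (of_with_C c), kmor_comp x (of_with_C c)).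
have tb : rel_triv F (with_C c) (g (with_C c) q) = q.
  exact: (@psmor_eq (Sch R[i]) _ _ _ _ tg (with_C c)).
pose b : F (as_real (with_C c)) := g (with_C c) q.
exists (pull (to_with_C c) b); split.
  by rewrite rel_proj_pull rel_projE tb; apply: kmor_ext.
rewrite (@triv_over_gen (with_C c)); last exact: kmor_ext.
by rewrite tb; apply: kmor_ext.
Qed.

Lemma tau_tau W (c : kmor W CC) : kmor_comp (tau R) (kmor_comp (tau R) c) = c.
Proof. by rewrite kmor_comp_assoc tauK kmor_comp_idl. Qed.

(** The transition map between the trivializations of [F] over [(W, c)] and
    over its complex conjugate. *)
Definition transition W (p : kmor W S) (c : kmor W CC) (x : kmor W X) :
    kmor W X :=
  triv_over (kmor_comp (tau R) c) (projT1 (cid (triv_over_surj c p x))).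

Lemma transitionE W (c : kmor W CC) (a : F W) :
  transition (rel_proj F W a) c (triv_over c a) =
  triv_over (kmor_comp (tau R) c) a.
Proof.
rewrite /transition; case: cid => b /= [pb tb]; congr triv_over.
exact: triv_over_inj tb.
Qed.

(** Conjugating twice restores [c], so the conjugate transition undoes the first. *)
Lemma transitionK W (p : kmor W S) (c : kmor W CC) (x : kmor W X) :
  transition p (kmor_comp (tau R) c) (transition p c x) = x.
Proof.
have [a [<- <-]] := triv_over_surj c p x.
by rewrite !transitionE tau_tau.
Qed.

Lemma transition_nat W W' (f : kmor W' W) (p : kmor W S) (c : kmor W CC)
    (x : kmor W X) :
  transition (kmor_comp p f) (kmor_comp c f) (kmor_comp x f) =
  kmor_comp (transition p c x) f.
Proof.
have [a [<- <-]] := triv_over_surj c p x.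
rewrite -rel_proj_pull -triv_over_nat !transitionE -triv_over_nat.
by rewrite kmor_comp_assoc.
Qed.

Notation Q := (fp (base_C S) X).
Notation qS := (kmor_comp (pr1 S CC) (pr1 (base_C S) X)).
Notation qC := (kmor_comp (pr2 S CC) (pr1 (base_C S) X)).

(** As in the Yoneda lemma, the natural operation [transition] is given by its value at the
    universal point; the conjugate transition provides the inverse. *)
Lemma classifying_aut_exists :
  exists Psi : Aut X (base_C S),
    fibre Psi = transition qS qC (pr2 (base_C S) X).
Proof.
(* The two inverse laws differ by exchanging [qC] with its conjugate and are proved together. *)
have inv (c c' : kmor Q CC) (y : kmor Q X) : kmor_comp (tau R) c' = c ->
    kmor_comp c (pairing (pr1 (base_C S) X) y) = c ->
    y = transition qS c' (pr2 (base_C S) X) ->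
    kmor_comp (transition qS c (pr2 (base_C S) X))
      (pairing (pr1 (base_C S) X) y) = pr2 (base_C S) X.
  move=> cc' cy ye; rewrite -transition_nat pr2_pairing cy {2}ye.
  rewrite -kmor_comp_assoc pr1_pairing -cc'; exact: transitionK.
apply: (aut_of_fibres (g := transition qS (kmor_comp (tau R) qC) (pr2 _ _))).
  apply: (inv _ (kmor_comp (tau R) qC)) => //; first exact: (tau_tau qC).
  exact: kmor_ext.
by apply: (inv _ qC) => //; exact: kmor_ext.
Qed.

Definition classifying_aut : Aut X (base_C S) :=
  projT1 (cid classifying_aut_exists).

Lemma act_classifying W (h : kmor W (base_C S)) (x : kmor W X) :
  act (pull h classifying_aut) x =
  transition (kmor_comp (pr1 S CC) h) (kmor_comp (pr2 S CC) h) x.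
Proof.
rewrite /act fibre_pull /classifying_aut; case: cid => Psi /= ->.
rewrite -kmor_comp_assoc -transition_nat.
by congr transition; apply: kmor_ext.
Qed.

Lemma fibre_act T (f : Aut X T) : fibre f = act (pull (pr1 T X) f) (pr2 T X).
Proof.
rewrite /act fibre_pull; apply: kmor_ext => A p /=.
by congr (sval (sval f A _)).2; apply: fp_ext.
Qed.

(** At the universal point this says that passing to the conjugate trivialization and back is the
    identity. *)
Lemma classifying_aut_twisted : is_twisted classifying_aut.
Proof.
apply: fibre_ext; rewrite fibre_act pull_mul act_mul -pull_comp.
rewrite !act_classifying fibre_one -[RHS](transitionK qS qC).
by congr transition; apply: kmor_ext.
Qed.

Definition classifying_point : twist (Aut X) S :=
  exist _ _ classifying_aut_twisted.

Definition classifying_map : psmor (point_functor S) (twist (Aut X)) :=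
  @PSMor (Sch R) (point_functor S) (twist (Aut X))
    (fun T (p : kmor T S) => pull p classifying_point)
    (fun T W (h : kmor W T) (p : kmor T S) => pull_comp p h classifying_point).

Notation bc := (base_change (universal_form X) classifying_map).

Definition compare_section T (a : F T) : kmor (base_C T) X :=
  triv_over (pr2 T CC) (pull (pr1 T CC) a).

(** The pullback of [a] to [T_C] is invariant under the involution, which conjugates the complex
    structure; so the conjugate section is the transition of the section. *)
Lemma compare_ok T (a : F T) :
  act (sval (pull (rel_proj F T a) classifying_point)) (compare_section a) =
  kmor_comp (compare_section a) (sigma T).
Proof.
rewrite [LHS]act_classifying -triv_over_nat -pull_comp.
have -> : kmor_comp (pr1 T CC) (sigma T) = pr1 T CC by apply: kmor_ext.
have -> : kmor_comp (pr2 T CC) (sigma T) = kmor_comp (tau R) (pr2 T CC).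
  exact: kmor_ext.
rewrite -transitionE rel_proj_pull.
by congr transition; apply: kmor_ext.
Qed.

Definition compare_univ T (a : F T) : univ X T :=
  exist _ (pull (rel_proj F T a) classifying_point, compare_section a)
    (compare_ok a).

Definition compare_fun T (a : F T) : bc T :=
  exist _ (rel_proj F T a, compare_univ a) erefl.

Lemma compare_nat (T W : Sch R) (h : hom W T) (a : F T) :
  compare_fun (ps_map h a) = ps_map h (compare_fun a).
Proof.
have e : rel_proj F W (ps_map h a) = kmor_comp (rel_proj F T a) h.
  exact: rel_proj_pull.
apply: psfp_ext => //; apply: univ_ext => /=.
  by rewrite e; exact: (pull_comp _ _ classifying_point).
rewrite /compare_section -triv_over_nat -!pull_comp.
by congr triv_over; [|congr pull]; apply: kmor_ext.
Qed.

Definition compare : psmor F bc := @PSMor (Sch R) F bc compare_fun compare_nat.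

(** The two halves of Galois descent give injectivity and surjectivity, once elements over [T_C] are
    described by their coordinates in [S] and [X]. *)
Lemma compare_iso : galois_descent F -> psmor_iso compare.
Proof.
move=> desc; apply: psmor_bij_iso => T.
  move=> a b ab; have pab : rel_proj F T a = rel_proj F T b.
    exact: (congr1 (fun q : bc T => (sval q).1) ab).
  have tab : compare_section a = compare_section b.
    exact: (congr1 (fun q : bc T => (sval (sval q).2).2) ab).
  apply: (proj1 (desc T)); apply: triv_over_inj tab.
  by rewrite !rel_proj_pull pab.
case=> -[p [[z x] xz]] /= pz.
have [b [pb xb]] := triv_over_surj (pr2 T CC) (kmor_comp p (pr1 T CC)) x.
(* The equation satisfied by [x] in [univ] is exactly the invariance of [b]. *)
have sb : pull (sigma T) b = b.
  apply: (triv_over_inj (c := kmor_comp (pr2 T CC) (sigma T))).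
    rewrite rel_proj_pull pb -kmor_comp_assoc; congr kmor_comp.
    exact: kmor_ext.
  rewrite triv_over_nat xb.
  have -> : kmor_comp (pr2 T CC) (sigma T) = kmor_comp (tau R) (pr2 T CC).
    exact: kmor_ext.
  rewrite -transitionE xb pb; move: xz => /= <-.
  rewrite -[z]pz [LHS]act_classifying.
  by congr transition; apply: kmor_ext.
have [a ab] := proj2 (desc T) b sb.
have pa : rel_proj F T a = p.
  (* The component in [S] is known over [T_C] only, and the covering is an epimorphism. *)
  by apply: base_C_epi; rewrite -rel_proj_pull -pb; congr (rel_proj F _ _).
exists a; apply: psfp_ext => //; apply: univ_ext => /=.
  by rewrite pa -[z]pz.
by rewrite -xb /compare_section; congr triv_over.
Qed.

Lemma compare_form : galois_descent F -> relative_form_iso bc F.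
Proof.
move=> desc; exists compare; split.
- exact: compare_iso.
- exact: psmor_ext.
apply: psmor_ext => V a; rewrite [LHS]surjective_pairing; congr pair.
  by rewrite -rel_projE.
rewrite -triv_over_real [RHS]/= /compare_section -triv_over_nat -pull_comp.
(* Along [diag] the second complex structure of [V_C] restricts to that of [V]. *)
congr triv_over; first exact: kmor_ext.
by rewrite -[LHS]pull_id; congr pull; apply: kmor_ext.
Qed.

End Completeness.

Theorem theorem1 (R : realType) :
  exists (Z : grp_construction (Sch R))
         (zeta : forall X : RScheme R,
            psmor (complexify (Z (Aut X))) (complexify (Aut X))),
    (forall (X X' : RScheme R) (phi : grp_iso (Aut X) (Aut X')),
       psmor_comp (zeta X') (complexify_mor (gc_map Z phi)) =
       psmor_comp (complexify_mor phi) (zeta X)) /\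
    forall X : RScheme R,
      is_real_form (zeta X) /\
      (exists beta : Z (Aut X) (SpecR R) -> cocycles X,
         bijective beta /\
         forall z : Z (Aut X) (SpecR R),
           rmor_comp (swap X) (sval (beta z)) =
           rmor_comp
             (sval (zeta X (SpecC R)
                      (ps_map (to_point (as_real (SpecC R))
                               : @hom (Sch R) (as_real (SpecC R)) (SpecR R))
                         z)))
             (swap X)) /\
      exists u : relative_form X (Z (Aut X)),
        forall (S : RScheme R) (F : relative_form X (point_functor S)),
          galois_descent F ->
          exists Psi : psmor (point_functor S) (Z (Aut X)),
            relative_form_iso (base_change u Psi) F.
Proof.
exists (twist_construction R), (fun X => twist_triv (Aut X)).
split=> [X X' phi|X].
  apply: psmor_ext => V z; exact: (esym (pull_nat phi (diag V) (sval z))).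
split; first exact: twist_triv_iso.
split.
  exists (@cocycle_of R X); split; first exact: cocycle_of_bij.
  exact: cocycle_ofE.
exists (universal_form X) => S F desc; exists (classifying_map F).
exact: compare_form.
Qed.
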